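(* Let $(A,\rho_A,[\cdot,\cdot]_A)$ be a Lie algebroid over a manifold $M$, $E$ a vector bundle over $M$, and $\nabla:\Gamma(A)\to\mathscr{CDO}(E)$ an $\mathbb{R}$-linear connection of $A$ on $E$. Then for every $p\ge1$ the Chern character form $\mathrm{ch}_p(\nabla)\in\mathcal{A}lt^{2p}_{\mathbb{R}}(\Gamma(A);C^\infty(M))$ is closed (that is, $d_{A,\mathbb{R}}\,\mathrm{ch}_p(\nabla)=0$), and its cohomology class $$[\mathrm{ch}_p(\nabla)]\in H^{2p}_{\rho_A,\mathbb{R}}(A;M\times\mathbb{R})$$ does not depend on the choice of the $\mathbb{R}$-linear connection $\nabla$ of $A$ on $E$.
   Context: All manifolds, bundles and sections are smooth; vector bundles are real. A Lie algebroid $(A,\rho_A,[\cdot,\cdot]_A)$ over $M$ is a vector bundle $A\to M$ with a vector bundle homomorphism $\rho_A:A\to TM$ (the anchor) and a real Lie algebra structure $[\cdot,\cdot]_A$ on $\Gamma(A)$ satisfying $[a,fb]_A=f[a,b]_A+\rho_A(a)(f)\,b$ for $a,b\in\Gamma(A)$, $f\in C^\infty(M)$. The anchor induces a Lie algebra homomorphism $\Gamma(A)\to\mathfrak{X}(M)$, $a\mapsto\rho_A\circ a$. $\mathscr{CDO}(E)$ is the space of covariant differential operators of $E$: $\mathbb{R}$-linear $\ell:\Gamma(E)\to\Gamma(E)$ for which there is exactly one vector field $\tilde\ell\in\mathfrak{X}(M)$ with $\ell(f\zeta)=f\ell(\zeta)+\tilde\ell(f)\zeta$ for all $f\in C^\infty(M)$,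 $\zeta\in\Gamma(E)$. An $\mathbb{R}$-linear connection of $A$ on $E$ is an $\mathbb{R}$-linear (not necessarily $C^\infty(M)$-linear, nor local) map $\nabla:\Gamma(A)\to\mathscr{CDO}(E)$, $a\mapsto\nabla_a$, with $\widetilde{\nabla_a}=\rho_A\circ a$. Its curvature is $R^\nabla_{a,b}=\nabla_a\nabla_b-\nabla_b\nabla_a-\nabla_{[a,b]_A}\in\Gamma(\mathrm{End}\,E)$. $\mathcal{A}lt^n_{\mathbb{R}}(\Gamma(A);C^\infty(M))$ is the space of $\mathbb{R}$-multilinear antisymmetric maps $\Gamma(A)^n\to C^\infty(M)$ (for $n=0$: $C^\infty(M)$). The operator $d_{A,\mathbb{R}}$ on these is $$(d_{A,\mathbb{R}}\eta)(a_1,\dots,a_{n+1})=\sum_i(-1)^{i+1}(\rho_A\circ a_i)\bigl(\eta(a_1,\dots\hat{\imath}\dots,a_{n+1})\bigr)+\sum_{i<j}(-1)^{i+j}\eta([a_i,a_j]_A,a_1,\dots\hat{\imath}\dots\hat{\jmath}\dots,a_{n+1}),$$ and $H^\bullet_{\rho_A,\mathbb{R}}(A;M\times\mathbb{R})$ is the cohomology of the complex $(\mathcal{A}lt^\bullet_{\mathbb{R}}(\Gamma(A);C^\infty(M)),d_{A,\mathbb{R}})$. For $p\ge1$, $\mathrm{ch}_p(\nabla)=\mathrm{Tr}_*(R^\nabla)^p$, where $$(R^\nabla)^p(a_1,\dots,a_{2p})=\frac1{2^p}\sum_{\tau\in S_{2p}}\mathrm{sgn}\,\tau\; R^\nabla_{a_{\tau(1)},a_{\tau(2)}}\circ\cdots\circ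 R^\nabla_{a_{\tau(2p-1)},a_{\tau(2p)}}$$ and $\mathrm{Tr}_*$ takes the fibrewise trace of the values. *)

(* Defs.v *)
From HB Require Import structures.
From mathcomp Require Import all_boot all_order all_algebra all_fingroup.
From mathcomp Require Import all_classical all_reals all_analysis.

Set Implicit Arguments.
Unset Strict Implicit.
Unset Printing Implicit Defensive.

Import Order.TTheory GRing.Theory Num.Theory.
Import numFieldNormedType.Exports.

Local Open Scope classical_set_scope.
Local Open Scope ring_scope.

(* For U open: f is of class C^k on U, in terms of Fréchet differentials.  In
   finite dimension, df is C^k as soon as every x |-> df_x(v) is. *)
Fixpoint Ck (R : realType) (V W : normedModType R) (k : nat) (U : set V)
    (f : V -> W) : Prop :=
  if k is k'.+1 then
    (forall x, U x -> differentiable f x) /\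
    (forall v, Ck k' U (fun x => 'd f x v))
  else forall x, U x -> {for x, continuous f}.

Definition Cinfty (R : realType) (V W : normedModType R) (U : set V)
  (f : V -> W) : Prop := forall k, Ck k U f.

Section CkTheory.
Variables (R : realType) (V : normedModType R).

Lemma near_eq_diff (W : normedModType R) (f g : V -> W) (x : V) :
  (\near x, f x = g x) -> differentiable f x ->
  differentiable g x /\ 'd g x = 'd f x :> (V -> W).
Proof.
move=> fg df; have fgx : f x = g x := nbhs_singleton fg.
have gf : g \o shift x = cst (g x) + 'd f x +o_ 0 id.
  apply/eqaddoP => _/posnumP[e].
  have /eqaddoP /(_ e%:num (gt0 e)) := diff_locally df.
  have fg' : \forall y \near 0, f (y + x) = g (y + x).
    by move: fg; rewrite (near_shift 0 x) subr0.
  apply: filterS2 fg' => y E /=.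
  by rewrite /= !fctE /= -E -fgx.
have E := diff_unique (diff_continuous df) gf.
split=> //; apply/diff_locallyP; rewrite E; split => //.
exact: diff_continuous df.
Qed.

Lemma Ck_ext (W : normedModType R) k (U : set V) (f g : V -> W) : open U ->
  (forall x, U x -> f x = g x) -> Ck k U f -> Ck k U g.
Proof.
move=> oU.
have nearfg (f' g' : V -> W) : (forall x, U x -> f' x = g' x) ->
    forall x, U x -> \forall y \near x, f' y = g' y.
  move=> fg x Ux; apply: filterS (open_nbhs_nbhs (conj oU Ux)) => y; exact: fg.
elim: k f g => [|k IH] f g fg /=.
  move=> cf x Ux.
  rewrite /prop_for /continuous_at -(fg x Ux).
  by apply: cvg_trans (cf x Ux); apply: near_eq_cvg; exact: nearfg.
case=> df Cf; split=> [x Ux|v].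
  by have [] := near_eq_diff (nearfg _ _ fg x Ux) (df x Ux).
apply: IH (Cf v) => x Ux.
by have [_ ->] := near_eq_diff (nearfg _ _ fg x Ux) (df x Ux).
Qed.

Lemma Ck_sub (W : normedModType R) k (U U' : set V) (f : V -> W) :
  U `<=` U' -> Ck k U' f -> Ck k U f.
Proof.
move=> sU; elim: k f => [|k IH] f /=; first by move=> cf x /sU; apply: cf.
by case=> df Cf; split=> [x /sU|v]; [apply: df | apply: IH].
Qed.

Lemma Ck_bigcup (W : normedModType R) k (I : Type) (U : I -> set V)
  (f : V -> W) : (forall i, Ck k (U i) f) -> Ck k (\bigcup_i U i) f.
Proof.
elim: k f => [|k IH] f /= H; first by move=> x [i _]; apply: H.
split=> [x [i _]|v]; first by apply: (H i).1.
by apply: IH => i; apply: (H i).2.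
Qed.

Lemma CkS (W : normedModType R) k (U : set V) (f : V -> W) :
  Ck k.+1 U f -> Ck k U f.
Proof.
elim: k f => [|k IH] f.
  by case=> df _ x /df; exact: differentiable_continuous.
by case=> df Cf; split=> // v; apply: IH.
Qed.

Lemma Ck_cst (W : normedModType R) k (U : set V) (a : W) :
  Ck k U (fun=> a).
Proof.
elim: k a => [|k IH] a /=; first by move=> x _; exact: cvg_cst.
split=> [x _|v]; first exact: differentiable_cst.
rewrite (_ : (fun x => _) = fun=> 0) //.
by apply/funext => x; rewrite diff_cst.
Qed.

Lemma CkD (W : normedModType R) k (U : set V) (f g : V -> W) : open U ->
  Ck k U f -> Ck k U g -> Ck k U (fun x => f x + g x).
Proof.
move=> oU; elim: k f g => [|k IH] f g /=.
  by move=> cf cg x Ux; apply: cvgD; [apply: cf | apply: cg].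
move=> [df Cf] [dg Cg]; split=> [x Ux|v].
  by apply: differentiableD; [apply: df | apply: dg].
apply: Ck_ext (IH _ _ (Cf v) (Cg v)) => // x Ux.
by rewrite [in RHS](diffD (df x Ux) (dg x Ux)).
Qed.

Lemma CkM k (U : set V) (f g : V -> R) : open U ->
  Ck k U f -> Ck k U g -> Ck k U (fun x => f x * g x).
Proof.
move=> oU; elim: k f g => [|k IH] f g.
  by move=> cf cg x Ux; apply: cvgM; [apply: cf | apply: cg].
move=> Hf Hg; have [[df Cf] [dg Cg]] := (Hf, Hg); split=> [x Ux|v].
  by apply: differentiableM; [apply: df | apply: dg].
have := CkD oU (IH _ _ (CkS Hf) (Cg v)) (IH _ _ (CkS Hg) (Cf v)).
by apply: Ck_ext => // x Ux; rewrite [in RHS](diffM (df x Ux) (dg x Ux)).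
Qed.

End CkTheory.

(* The values of cmap outside cdom, and of cinv outside crange, are
   irrelevant. *)
Record chart (R : realType) (M : topologicalType) (n : nat) := Chart {
  cdom : set M;
  crange : set 'rV[R]_n;
  cmap : M -> 'rV[R]_n;
  cinv : 'rV[R]_n -> M;
  cdom_open : open cdom;
  crange_open : open crange;
  cmap_range : forall x, cdom x -> crange (cmap x);
  cinv_dom : forall y, crange y -> cdom (cinv y);
  cmapK : forall x, cdom x -> cinv (cmap x) = x;
  cinvK : forall y, crange y -> cmap (cinv y) = y;
  cmap_continuous : forall x, cdom x -> {for x, continuous cmap};
  cinv_continuous : forall y, crange y -> {for y, continuous cinv} }.

(* The image of U under the chart c. *)
Definition chart_img (R : realType) (M : topologicalType) (n : nat)
  (c : chart R M n) (U : set M) : set 'rV[R]_n :=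
  [set y | crange c y /\ U (cinv c y)].

Lemma chart_img_open (R : realType) (M : topologicalType) (n : nat)
  (c : chart R M n) (U : set M) : open U -> open (chart_img c U).
Proof.
move=> oU; rewrite openE => y [cy Uy]; rewrite /interior.
have cN : nbhs y (crange c).
  by apply: open_nbhs_nbhs; split=> //; exact: crange_open.
have UN : nbhs (cinv c y) U by apply: open_nbhs_nbhs.
exact: filterI cN (cinv_continuous cy UN).
Qed.

Record manifold (R : realType) := Manifold {
  msort :> topologicalType;
  mdim : nat;
  atlas : set (chart R msort mdim);
  mfd_hausdorff : hausdorff_space msort;
  mfd_second_countable : @second_countable msort;
  mfd_cover : forall x : msort, exists2 c, atlas c & cdom c x;
  mfd_compat : forall c c', atlas c -> atlas c' ->
    Cinfty (chart_img c (cdom c')) (cmap c' \o cinv c) }.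

(* For U open. *)
Definition smooth_on (R : realType) (M : manifold R) (U : set M)
  (f : M -> R) : Prop :=
  forall c, atlas c -> Cinfty (chart_img c U) (f \o cinv c).

Section SmoothOn.
Variables (R : realType) (M : manifold R).
Implicit Types (U : set M) (f g : M -> R).

Lemma smooth_on_ext U f g : open U -> (forall x, U x -> f x = g x) ->
  smooth_on U f -> smooth_on U g.
Proof.
move=> oU fg sf c ac k; apply: Ck_ext (sf c ac k).
  exact: chart_img_open.
by move=> y [_ Uy]; apply: fg.
Qed.

Lemma smooth_on_sub U U' f : U `<=` U' -> smooth_on U' f -> smooth_on U f.
Proof. by move=> sU sf c ac k; apply: Ck_sub (sf c ac k) => y [cy /sU]. Qed.

Lemma smooth_on_loc U f :
  (forall x, U x -> exists2 W, W x & smooth_on W f) -> smooth_on U f.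
Proof.
move=> H c ac k.
pose J := {W : set M | smooth_on W f}.
apply: (@Ck_sub _ _ _ _ _ (\bigcup_(W : J) chart_img c (sval W))).
  by move=> y [cy /H [W Wy sW]]; exists (exist _ W sW).
by apply: Ck_bigcup => -[W /= sW]; apply: sW.
Qed.

Lemma smooth_on_cst U (a : R) : smooth_on U (fun=> a).
Proof. by move=> c ac k; apply: Ck_cst. Qed.

Lemma smooth_onD U f g : open U ->
  smooth_on U f -> smooth_on U g -> smooth_on U (fun x => f x + g x).
Proof.
move=> oU sf sg c ac k.
have := CkD (@chart_img_open _ _ _ c _ oU) (sf c ac k) (sg c ac k).
exact.
Qed.

Lemma smooth_onM U f g : open U ->
  smooth_on U f -> smooth_on U g -> smooth_on U (fun x => f x * g x).
Proof.
move=> oU sf sg c ac k.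
have := CkM (@chart_img_open _ _ _ c _ oU) (sf c ac k) (sg c ac k).
exact.
Qed.

Lemma smooth_onN U f : open U ->
  smooth_on U f -> smooth_on U (fun x => - f x).
Proof.
move=> oU sf; apply: smooth_on_ext (smooth_onM oU (smooth_on_cst U (-1)) sf).
  exact: oU.
by move=> x _; rewrite mulN1r.
Qed.

Lemma smooth_on_sum U (I : Type) (r : seq I) (F : I -> M -> R) : open U ->
  (forall i, smooth_on U (F i)) -> smooth_on U (fun x => \sum_(i <- r) F i x).
Proof.
move=> oU sF; elim: r => [|i r IH].
  by apply: smooth_on_ext (smooth_on_cst U 0) => // x _; rewrite big_nil.
apply: smooth_on_ext (smooth_onD oU (sF i) IH) => // x _.
by rewrite big_cons.
Qed.

End SmoothOn.

(* C^oo(M) *)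
Record smooth_fun (R : realType) (M : manifold R) := SmoothFun {
  sfun :> M -> R;
  sfunP : smooth_on setT sfun }.

Section SmoothFun.
Variables (R : realType) (M : manifold R).
Local Notation C := (smooth_fun M).

Lemma smooth_fun_ext (f g : C) : (forall x, f x = g x) -> f = g.
Proof.
case: f g => [f sf] [g sg] /= /funext fg; case: _ / fg in sg *.
by congr SmoothFun; exact: Prop_irrelevance.
Qed.

HB.instance Definition _ := gen_eqMixin C.
HB.instance Definition _ := gen_choiceMixin C.

Definition sf0 : C := SmoothFun (smooth_on_cst setT 0).
Definition sf1 : C := SmoothFun (smooth_on_cst setT 1).
Definition sfN (f : C) : C := SmoothFun (smooth_onN openT (sfunP f)).
Definition sfD (f g : C) : C :=
  SmoothFun (smooth_onD openT (sfunP f) (sfunP g)).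
Definition sfM (f g : C) : C :=
  SmoothFun (smooth_onM openT (sfunP f) (sfunP g)).
Definition sfZ (k : R) (f : C) : C :=
  SmoothFun (smooth_onM openT (smooth_on_cst setT k) (sfunP f)).

Fact sfDA : associative sfD.
Proof. by move=> f g h; apply: smooth_fun_ext => x /=; rewrite addrA. Qed.
Fact sfDC : commutative sfD.
Proof. by move=> f g; apply: smooth_fun_ext => x /=; rewrite addrC. Qed.
Fact sf0D : left_id sf0 sfD.
Proof. by move=> f; apply: smooth_fun_ext => x /=; rewrite add0r. Qed.
Fact sfND : left_inverse sf0 sfN sfD.
Proof. by move=> f; apply: smooth_fun_ext => x /=; rewrite addNr. Qed.
HB.instance Definition _ := GRing.isZmodule.Build C sfDA sfDC sf0D sfND.

Fact sfMA : associative sfM.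
Proof. by move=> f g h; apply: smooth_fun_ext => x /=; rewrite mulrA. Qed.
Fact sfMC : commutative sfM.
Proof. by move=> f g; apply: smooth_fun_ext => x /=; rewrite mulrC. Qed.
Fact sf1M : left_id sf1 sfM.
Proof. by move=> f; apply: smooth_fun_ext => x /=; rewrite mul1r. Qed.
Fact sfMDl : left_distributive sfM sfD.
Proof. by move=> f g h; apply: smooth_fun_ext => x /=; rewrite mulrDl. Qed.
HB.instance Definition _ :=
  GRing.Zmodule_isComPzRing.Build C sfMA sfMC sf1M sfMDl.

Fact sfZA a b f : sfZ a (sfZ b f) = sfZ (a * b) f.
Proof. by apply: smooth_fun_ext => x /=; rewrite mulrA. Qed.
Fact sf1Z : left_id 1 sfZ.
Proof. by move=> f; apply: smooth_fun_ext => x /=; rewrite mul1r. Qed.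
Fact sfZDr : right_distributive sfZ +%R.
Proof. by move=> a f g; apply: smooth_fun_ext => x /=; rewrite mulrDr. Qed.
Fact sfZDl f : {morph sfZ^~ f : a b / a + b}.
Proof. by move=> a b; apply: smooth_fun_ext => x /=; rewrite mulrDl. Qed.
HB.instance Definition _ :=
  GRing.Zmodule_isLmodule.Build R C sfZA sf1Z sfZDr sfZDl.

End SmoothFun.

(* A local trivialization over tdom; the values of tmap and tinv at points
   outside tdom are irrelevant. *)
Record triv (R : realType) (M : manifold R) (F : M -> lmodType R) := Triv {
  tdom : set M;
  trank : nat;
  tmap : forall x, {linear F x -> 'rV[R]_trank};
  tinv : forall x, {linear 'rV[R]_trank -> F x};
  tdom_open : open tdom;
  tmapK : forall x, tdom x -> cancel (tmap x) (tinv x);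
  tinvK : forall x, tdom x -> cancel (tinv x) (tmap x) }.

(* A smooth vector bundle, presented by its fibres and by local
   trivializations with smooth transition functions. *)
Record vbundle (R : realType) (M : manifold R) := VBundle {
  fiber :> M -> lmodType R;
  vtrivs : set (triv fiber);
  vcover : forall x, exists2 t, vtrivs t & tdom t x;
  vcompat : forall s t, vtrivs s -> vtrivs t -> forall v k,
    smooth_on (tdom s `&` tdom t) (fun x => tmap t x (tinv s x v) 0 k) }.

(* Gamma(E) *)
Record section (R : realType) (M : manifold R) (E : vbundle M) := MkSection {
  sec_at :> forall x, E x;
  sectionP : forall t, vtrivs t -> forall k,
    smooth_on (tdom t) (fun x => tmap t x (sec_at x) 0 k) }.

Notation "''Gamma' ( E )" := (section E)
  (at level 8, format "''Gamma' ( E )") : type_scope.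

Section SectionTheory.
Variables (R : realType) (M : manifold R) (E : vbundle M).
Local Notation S := 'Gamma(E).

Lemma section_ext (s u : S) : (forall x, s x = u x) -> s = u.
Proof.
case: s u => [s ss] [u su] /= H.
have E' := functional_extensionality_dep H.
by case: _ / E' in su H *; congr MkSection; exact: Prop_irrelevance.
Qed.

HB.instance Definition _ := gen_eqMixin S.
HB.instance Definition _ := gen_choiceMixin S.

Fact sec0_smooth t : vtrivs t -> forall k,
  smooth_on (tdom t) (fun x => tmap t x (0 : E x) 0 k).
Proof.
move=> _ k; apply: smooth_on_ext (smooth_on_cst _ 0); first exact: tdom_open.
by move=> x _; rewrite linear0 mxE.
Qed.
Fact secN_smooth (s : S) t : vtrivs t -> forall k,
  smooth_on (tdom t) (fun x => tmap t x (- s x) 0 k).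
Proof.
move=> vt k; have ot := tdom_open t.
apply: smooth_on_ext (smooth_onN ot (sectionP s vt k)) => // x _.
by rewrite linearN mxE.
Qed.
Fact secD_smooth (s u : S) t : vtrivs t -> forall k,
  smooth_on (tdom t) (fun x => tmap t x (s x + u x) 0 k).
Proof.
move=> vt k; have ot := tdom_open t.
apply: smooth_on_ext (smooth_onD ot (sectionP s vt k) (sectionP u vt k)) => //.
by move=> x _; rewrite linearD mxE.
Qed.
Fact secM_smooth (f : smooth_fun M) (s : S) t : vtrivs t -> forall k,
  smooth_on (tdom t) (fun x => tmap t x (f x *: s x) 0 k).
Proof.
move=> vt k; have ot := tdom_open t.
have sf : smooth_on (tdom t) f := smooth_on_sub (@subsetT _ _) (sfunP f).
apply: smooth_on_ext (smooth_onM ot sf (sectionP s vt k)) => //.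
by move=> x _; rewrite linearZ mxE.
Qed.

Definition sec0 : S := MkSection sec0_smooth.
Definition secN (s : S) : S := MkSection (secN_smooth s).
Definition secD (s u : S) : S := MkSection (secD_smooth s u).
(* multiplication by functions *)
Definition secM (f : smooth_fun M) (s : S) : S := MkSection (secM_smooth f s).
Definition secZ (a : R) (s : S) : S :=
  secM (SmoothFun (smooth_on_cst setT a)) s.

Fact secDA : associative secD.
Proof. by move=> s u v; apply: section_ext => x /=; rewrite addrA. Qed.
Fact secDC : commutative secD.
Proof. by move=> s u; apply: section_ext => x /=; rewrite addrC. Qed.
Fact sec0D : left_id sec0 secD.
Proof. by move=> s; apply: section_ext => x /=; rewrite add0r. Qed.
Fact secND : left_inverse sec0 secN secD.
Proof. by move=> s; apply: section_ext => x /=; rewrite addNr. Qed.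
HB.instance Definition _ := GRing.isZmodule.Build S secDA secDC sec0D secND.

Fact secZA a b s : secZ a (secZ b s) = secZ (a * b) s.
Proof. by apply: section_ext => x /=; rewrite scalerA. Qed.
Fact sec1Z : left_id 1 secZ.
Proof. by move=> s; apply: section_ext => x /=; rewrite scale1r. Qed.
Fact secZDr : right_distributive secZ +%R.
Proof. by move=> a s u; apply: section_ext => x /=; rewrite scalerDr. Qed.
Fact secZDl s : {morph secZ^~ s : a b / a + b}.
Proof. by move=> a b; apply: section_ext => x /=; rewrite scalerDl. Qed.
HB.instance Definition _ :=
  GRing.Zmodule_isLmodule.Build R S secZA sec1Z secZDr secZDl.

End SectionTheory.

Notation "f *:: s" := (secM f s) (at level 40, left associativity).

(* T_x M: the derivations of C^oo(M) at x. *)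
Record tangent (R : realType) (M : manifold R) (x : M) := Tangent {
  tvec :> smooth_fun M -> R;
  tvec_linear : forall k f g, tvec (k *: f + g) = k * tvec f + tvec g;
  tvec_leibniz : forall f g, tvec (f * g) = f x * tvec g + g x * tvec f }.

Section TangentTheory.
Variables (R : realType) (M : manifold R) (x : M).
Local Notation T := (tangent x).

Lemma tangent_ext (v w : T) : (forall f, v f = w f) -> v = w.
Proof.
case: v w => [v v1 v2] [w w1 w2] /= /funext vw; case: _ / vw in w1 w2 *.
by congr Tangent; exact: Prop_irrelevance.
Qed.

HB.instance Definition _ := gen_eqMixin T.
HB.instance Definition _ := gen_choiceMixin T.

Fact tan0_linear (k : R) (f g : smooth_fun M) : (0 : R) = k * 0 + 0.
Proof. by rewrite mulr0 addr0. Qed.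
Fact tan0_leibniz (f g : smooth_fun M) : (0 : R) = f x * 0 + g x * 0.
Proof. by rewrite !mulr0 addr0. Qed.
Definition tan0 : T := @Tangent R M x (fun=> 0) tan0_linear tan0_leibniz.

Fact tanN_linear (v : T) k f g : - v (k *: f + g) = k * - v f + - v g.
Proof. by rewrite tvec_linear opprD mulrN. Qed.
Fact tanN_leibniz (v : T) f g : - v (f * g) = f x * - v g + g x * - v f.
Proof. by rewrite tvec_leibniz opprD !mulrN. Qed.
Definition tanN (v : T) : T :=
  @Tangent R M x (fun f => - v f) (tanN_linear v) (tanN_leibniz v).

Fact tanD_linear (v w : T) k f g :
  v (k *: f + g) + w (k *: f + g) = k * (v f + w f) + (v g + w g).
Proof. by rewrite !tvec_linear mulrDr addrACA. Qed.
Fact tanD_leibniz (v w : T) f g :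
  v (f * g) + w (f * g) = f x * (v g + w g) + g x * (v f + w f).
Proof. by rewrite !tvec_leibniz !mulrDr addrACA. Qed.
Definition tanD (v w : T) : T :=
  @Tangent R M x (fun f => v f + w f) (tanD_linear v w) (tanD_leibniz v w).

Fact tanZ_linear a (v : T) k f g :
  a * v (k *: f + g) = k * (a * v f) + a * v g.
Proof. by rewrite !tvec_linear mulrDr mulrCA. Qed.
Fact tanZ_leibniz a (v : T) f g :
  a * v (f * g) = f x * (a * v g) + g x * (a * v f).
Proof. by rewrite !tvec_leibniz mulrDr !(mulrCA a). Qed.
Definition tanZ (a : R) (v : T) : T :=
  @Tangent R M x (fun f => a * v f) (tanZ_linear a v) (tanZ_leibniz a v).

Fact tanDA : associative tanD.
Proof. by move=> u v w; apply: tangent_ext => f /=; rewrite addrA. Qed.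
Fact tanDC : commutative tanD.
Proof. by move=> u v; apply: tangent_ext => f /=; rewrite addrC. Qed.
Fact tan0D : left_id tan0 tanD.
Proof. by move=> v; apply: tangent_ext => f /=; rewrite add0r. Qed.
Fact tanND : left_inverse tan0 tanN tanD.
Proof. by move=> v; apply: tangent_ext => f /=; rewrite addNr. Qed.
HB.instance Definition _ := GRing.isZmodule.Build T tanDA tanDC tan0D tanND.

Fact tanZA a b v : tanZ a (tanZ b v) = tanZ (a * b) v.
Proof. by apply: tangent_ext => f /=; rewrite mulrA. Qed.
Fact tan1Z : left_id 1 tanZ.
Proof. by move=> v; apply: tangent_ext => f /=; rewrite mul1r. Qed.
Fact tanZDr : right_distributive tanZ +%R.
Proof. by move=> a u v; apply: tangent_ext => f /=; rewrite mulrDr. Qed.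
Fact tanZDl v : {morph tanZ^~ v : a b / a + b}.
Proof. by move=> a b; apply: tangent_ext => f /=; rewrite mulrDl. Qed.
HB.instance Definition _ :=
  GRing.Zmodule_isLmodule.Build R T tanZA tan1Z tanZDr tanZDl.

End TangentTheory.

(* A field of tangent vectors is smooth when it maps smooth functions to
   smooth functions. *)
Record vector_field (R : realType) (M : manifold R) := VectorField {
  vfield :> forall x : M, tangent x;
  vfieldP : forall f : smooth_fun M, smooth_on setT (fun x => vfield x f) }.

Definition vf_act (R : realType) (M : manifold R) (X : vector_field M)
  (f : smooth_fun M) : smooth_fun M := SmoothFun (vfieldP X f).

(* A vector bundle with a vector bundle homomorphism to TM: the smoothness of
   the anchor says that it maps local frames to smooth local vector fields. *)
Record anchored_bundle (R : realType) (M : manifold R) := AnchoredBundle {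
  ab_bundle :> vbundle M;
  anchor : forall x, {linear ab_bundle x -> tangent x};
  anchor_smooth : forall t, vtrivs t -> forall v (f : smooth_fun M),
    smooth_on (tdom t) (fun x => anchor x (tinv t x v) f) }.

Section Anchor.
Variables (R : realType) (M : manifold R) (A : anchored_bundle M).

Fact anchor_vf_smooth (a : 'Gamma(A)) (f : smooth_fun M) :
  smooth_on setT (fun x => anchor A x (a x) f).
Proof.
apply: smooth_on_loc => x _; have [t vt tx] := vcover A x.
exists (tdom t) => //; have ot := tdom_open t.
have sk k := smooth_onM ot (sectionP a vt k)
  (anchor_smooth vt (delta_mx 0 k) f).
apply: smooth_on_ext (smooth_on_sum (index_enum _) ot sk) => // y ty.
rewrite -{2}(tmapK ty (a y)) {2}(row_sum_delta (tmap t y (a y))) !linear_sum.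
have evD (F : 'I_(trank t) -> tangent y) :
    (\sum_k F k) f = \sum_k F k f :> R.
  by elim/big_rec2: _ => //= k p q _ <-.
by rewrite evD; apply: eq_bigr => k _; rewrite !linearZ.
Qed.

(* The vector field rho_A o a. *)
Definition anchor_vf (a : 'Gamma(A)) : vector_field M :=
  @VectorField R M (fun x => anchor A x (a x)) (anchor_vf_smooth a).

End Anchor.

Record lie_algebroid (R : realType) (M : manifold R) := LieAlgebroid {
  la_bundle :> anchored_bundle M;
  bracket : 'Gamma(la_bundle) -> 'Gamma(la_bundle) -> 'Gamma(la_bundle);
  bracket_linearl : forall k a b c,
    bracket (k *: a + b) c = k *: bracket a c + bracket b c;
  bracket_linearr : forall k a b c,
    bracket a (k *: b + c) = k *: bracket a b + bracket a c;
  bracket_alt : forall a, bracket a a = 0;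
  bracket_jacobi : forall a b c,
    bracket a (bracket b c) + bracket b (bracket c a) +
    bracket c (bracket a b) = 0;
  bracket_leibniz : forall a b (f : smooth_fun M),
    bracket a (f *:: b) = f *:: bracket a b + vf_act (anchor_vf a) f *:: b }.

Section CDO.
Variables (R : realType) (M : manifold R) (E : vbundle M).

Definition cdo_leibniz (l : 'Gamma(E) -> 'Gamma(E)) (X : vector_field M) :=
  forall (f : smooth_fun M) (s : 'Gamma(E)),
    l (f *:: s) = f *:: l s + vf_act X f *:: s.

Record cdo := CDO {
  cdo_op :> {linear 'Gamma(E) -> 'Gamma(E)};
  cdo_symbol : vector_field M;
  cdo_symbolP : cdo_leibniz cdo_op cdo_symbol;
  cdo_symbol_uniq : forall X, cdo_leibniz cdo_op X -> X = cdo_symbol }.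

End CDO.

Record connection (R : realType) (M : manifold R) (A : lie_algebroid M)
    (E : vbundle M) := Connection {
  conn :> 'Gamma(A) -> cdo E;
  conn_linear : forall k a b s,
    conn (k *: a + b) s = k *: conn a s + conn b s;
  conn_symbol : forall a, cdo_symbol (conn a) = anchor_vf a }.

(* Gamma(End E) *)
Record endo (R : realType) (M : manifold R) (E : vbundle M) := Endo {
  endo_at :> forall x, {linear E x -> E x};
  endoP : forall t, vtrivs t -> forall v k,
    smooth_on (tdom t) (fun x => tmap t x (endo_at x (tinv t x v)) 0 k) }.

Lemma lin1_mx_comp (R : comNzRingType) (m n p : nat)
  (f : {linear 'rV[R]_m -> 'rV[R]_n}) (g : {linear 'rV[R]_n -> 'rV[R]_p}) :
  lin1_mx (g \o f) = lin1_mx f *m lin1_mx g.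
Proof.
apply/row_matrixP => i; rewrite !rowE mulmxA mul_rV_lin1 /=.
by rewrite !mul_rV_lin1.
Qed.

Section Trace.
Variables (R : realType) (M : manifold R) (E : vbundle M).

(* The matrix of an endomorphism of E_x in a local trivialization around x. *)
Definition triv_mx (t : triv E) (x : M) (phi : E x -> E x) : 'M[R]_(trank t) :=
  lin1_mx (tmap t x \o phi \o tinv t x).

(* The trace of an endomorphism of E_x, computed in some local trivialization
   around x; by fiber_trE the choice is immaterial. *)
Definition fiber_tr (x : M) (phi : E x -> E x) : R :=
  \tr (triv_mx (s2val (cid2 (vcover E x))) phi).

Lemma fiber_trE (t : triv E) (x : M) (phi : {linear E x -> E x}) :
  tdom t x -> fiber_tr phi = \tr (triv_mx t phi).
Proof.
move=> tx; rewrite /fiber_tr; case: (cid2 _) => s /= _ sx.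
rewrite /triv_mx.
have -> : tmap s x \o phi \o tinv s x =
    (tmap s x \o tinv t x) \o (tmap t x \o phi \o tinv s x).
  by apply/funext => v /=; rewrite (tmapK tx).
rewrite (lin1_mx_comp (tmap t x \o phi \o tinv s x) (tmap s x \o tinv t x)).
rewrite mxtrace_mulC -lin1_mx_comp; congr (\tr (lin1_mx _)).
by apply/funext => v /=; rewrite (tmapK sx).
Qed.

Fact endo_tr_smooth (phi : endo E) :
  smooth_on setT (fun x => fiber_tr (endo_at phi x)).
Proof.
apply: smooth_on_loc => x _; have [t vt tx] := vcover E x.
exists (tdom t) => //; have ot := tdom_open t.
have sk k := endoP phi vt (delta_mx 0 k) k.
apply: smooth_on_ext (smooth_on_sum (index_enum _) ot sk) => // y ty.
rewrite (fiber_trE _ ty); apply: eq_bigr => k _.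
by rewrite /triv_mx mxE.
Qed.

Definition endo_tr (phi : endo E) : smooth_fun M :=
  SmoothFun (endo_tr_smooth phi).

(* Gamma(End E) is identified with the operators on Gamma(E) of the form
   s |-> phi o s; such a phi is unique.  The value is 0, by convention, on the
   other operators. *)
Definition Tr (T : 'Gamma(E) -> 'Gamma(E)) : smooth_fun M :=
  if pselect (exists phi : endo E, forall s x, T s x = phi x (s x)) is left ex
  then endo_tr (sval (cid ex)) else 0.

End Trace.

Section Curvature.
Variables (R : realType) (M : manifold R) (A : lie_algebroid M).
Variables (E : vbundle M) (nabla : connection A E).

Definition curvature (a b : 'Gamma(A)) (s : 'Gamma(E)) : 'Gamma(E) :=
  nabla a (nabla b s) - nabla b (nabla a s) - nabla (bracket a b) s.

End Curvature.

Section Cohomology.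
Variables (R : realType) (M : manifold R) (A : lie_algebroid M).

Definition cochain (n : nat) := ('I_n -> 'Gamma(A)) -> smooth_fun M.

(* Alt^n_R(Gamma(A); C^oo(M)) *)
Definition Alt (n : nat) (eta : cochain n) : Prop :=
  (forall (i : 'I_n) (a : 'I_n -> 'Gamma(A)) (k : R) (u v : 'Gamma(A)),
     let subst w := fun j => if j == i then w else a j in
     eta (subst (k *: u + v)) = k *: eta (subst u) + eta (subst v)) /\
  (forall (tau : 'S_n) (a : 'I_n -> 'Gamma(A)),
     eta (a \o tau) = (-1) ^+ tau *: eta a).

(* ([a_i, a_j], a_0, .., ^i, .., ^j, .., a_n) for i < j *)
Definition bracket_args (n : nat) (a : 'I_n.+1 -> 'Gamma(A)) (i j : 'I_n.+1)
  (k : 'I_n) : 'Gamma(A) :=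
  if k == 0%N :> nat then bracket (a i) (a j)
  else a (inord (bump j (bump i k.-1))).

(* Indices start from 0: the signs (-1)^(i+1) become (-1)^i. *)
Definition dA (n : nat) (eta : cochain n) : cochain n.+1 := fun a =>
  \sum_(i < n.+1) (-1) ^+ i *: vf_act (anchor_vf (a i)) (eta (a \o lift i)) +
  \sum_(i < n.+1) \sum_(j < n.+1 | (i < j)%N)
     (-1) ^+ (i + j) *: eta (bracket_args a i j).

Definition coboundary (n : nat) : cochain n -> Prop :=
  if n is m.+1 then fun eta => exists2 theta : cochain m, Alt theta &
                                 dA theta = eta
  else fun eta => eta = (fun=> 0).

Definition cocycle (n : nat) (eta : cochain n) : Prop :=
  Alt eta /\ dA eta = (fun=> 0).

(* The class of a cocycle eta in H^n: its coset modulo coboundaries. *)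
Definition coh_class (n : nat) (eta : cochain n) : set (cochain n) :=
  [set omega | cocycle omega /\ coboundary (fun a => omega a - eta a)].

End Cohomology.

Section Chern.
Variables (R : realType) (M : manifold R) (A : lie_algebroid M).
Variables (E : vbundle M) (nabla : connection A E).

Fact ord_double_subproof p (i : 'I_p) : (i.*2 < p.*2)%N.
Proof. by rewrite ltn_double. Qed.
Fact ord_doubleS_subproof p (i : 'I_p) : (i.*2.+1 < p.*2)%N.
Proof. by rewrite -doubleS leq_double. Qed.
Definition ord_double p (i : 'I_p) : 'I_p.*2 := Ordinal (ord_double_subproof i).
Definition ord_doubleS p (i : 'I_p) : 'I_p.*2 :=
  Ordinal (ord_doubleS_subproof i).

(* (R^nabla)^p, as an operator on sections *)
Definition curvature_pow (p : nat) (a : 'I_p.*2 -> 'Gamma(A))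
  (s : 'Gamma(E)) : 'Gamma(E) :=
  (2 ^+ p)^-1 *: \sum_(tau : 'S_(p.*2)) (-1) ^+ tau *:
    (\big[comp/id]_(i < p)
       curvature nabla (a (tau (ord_double i))) (a (tau (ord_doubleS i)))) s.

Definition ch (p : nat) : cochain A p.*2 := fun a => Tr (curvature_pow a).

End Chern.

Arguments ch {R M A E} nabla p a.

(* Main.v *)
(* The connection need not be local, so everything takes place in the
   Chevalley-Eilenberg complex of the real Lie algebra g = Gamma(A), whose
   differential is characterized by Cartan's formula iota_a d = L_a - d iota_a.
   In the ring of operators on Gamma(E) let d_D be the differential for the
   action of a by the commutator with D_a.  The Jacobi identities give Bianchi's
   d_D R = 0, d_D is an antiderivation, and Tr [D_a, T] = rho(a)(Tr T) for T
   tensorial; hence d Tr R^p = Tr d_D R^p = 0.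
   For two connections D, D' put D_t = D + t B with B = D' - D, a connection
   over the polynomials in t, of curvature R_t.  Then d R_t / dt = d_{D_t} B,
   and with Q_0 = 0, Q_{p+1} = R_t Q_p + B R_t^p one has
   d_{D_t} Q_p = d (R_t^p) / dt, so that the integral of Tr Q_p over [0, 1] is a
   primitive of the difference of the Chern forms.
   The geometric input is a bump function around every point.  It provides
   sections e_i and C^oo-linear forms th_i with f s = sum_i th_i(s) e_i and
   f Tr T = sum_i th_i(T e_i), where f = 1 at that point. *)

From HB Require Import structures.
Require Import Defs.
From mathcomp Require Import all_boot all_order all_algebra all_fingroup.
From mathcomp Require Import all_classical all_reals all_analysis.
From mathcomp Require Import ring.

Set Implicit Arguments.
Unset Strict Implicit.
Unset Printing Implicit Defensive.

Import Order.TTheory GRing.Theory Num.Theory.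
Import numFieldNormedType.Exports.

Local Open Scope ring_scope.

(** * Inhomogeneous cochains *)

(** Two obstacles shape the proof. The operators D_a need not be tensorial, so they have no trace of
    their own, and [Tr] is additive only where it is meaningful. The rule for Tr [D_a, T] therefore
    stands in for the cyclicity of the trace. Taken for two connections at once, it gives Tr
    [B_a, T] = 0, which is why one and the same action governs the traces along the whole family
    D_t. The other obstacle is signs. The Chern form is a sum over permutations and the differential
    a sum over omitted indices; neither suits induction on the number of arguments. Hence the
    recursions on the first argument. The two sums are recovered separately: antisymmetrizing a
    concatenation product gives the wedge product of the antisymmetrizations, and antisymmetrizing R
    gives 2R, which accounts for the factor 1/2^p. The integral over t is formal: t^k receives the
    weight 1/(k+1), and the coefficients are operators. Analysis enters only through the bump
    functions. *)

(* A cochain is a function on all lists of arguments; its component of degree n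
   is its restriction to the lists of length n. *)
Definition contr (g V : Type) (a : g) (w : seq g -> V) : seq g -> V :=
  fun s => w (a :: s).

Lemma contrD (g : Type) (V : nmodType) (a : g) (w h : seq g -> V) :
  contr a (w \+ h) = contr a w \+ contr a h.
Proof. by []. Qed.

Lemma contrN (g : Type) (V : zmodType) (a : g) (w : seq g -> V) :
  contr a (\- w) = \- contr a w.
Proof. by []. Qed.

Lemma contrZ (g : Type) (V : pzRingType) (a : g) c (w : seq g -> V) :
  contr a (fun s => c * w s) = fun s => c * contr a w s.
Proof. by []. Qed.

Section Shuffle.
Variables (g : Type) (V : pzRingType).
Implicit Types (w h : seq g -> V) (s : seq g).

(** The grading involution; the signs in the wedge product come from it alone. *)
Definition par w : seq g -> V := fun s => (-1) ^+ size s * w s.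

(* The wedge product, given by the fact that contractions are
   antiderivations. *)
Fixpoint shuf w h s : V :=
  if s is a :: s' then shuf (contr a w) h s' + shuf (par w) (contr a h) s'
  else w [::] * h [::].

Definition unit_cochain : seq g -> V := fun s => if s is [::] then 1 else 0.

Lemma parD w h : par (w \+ h) = par w \+ par h.
Proof. by apply/funext => s; rewrite /par /= mulrDr. Qed.

Lemma parK : involutive par.
Proof. by move=> w; apply/funext => s; rewrite /par signrMK. Qed.

Lemma contr_par a w : contr a (par w) = \- par (contr a w).
Proof. by apply/funext => s; rewrite /contr /par /= exprS mulN1r mulNr. Qed.

Definition central (c : V) := forall x, GRing.comm c x.

Lemma centralN1 : central (-1).
Proof. by move=> x; apply/commr_sym/commrN1. Qed.

Lemma parZ c w : central c -> par (fun s => c * w s) = fun s => c * par w s.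
Proof. by move=> cC; apply/funext => s; rewrite /par !mulrA cC. Qed.

Lemma oppE w : \- w = fun s => -1 * w s.
Proof. by apply/funext => s /=; rewrite mulN1r. Qed.

Lemma shufDl w1 w2 h s : shuf (w1 \+ w2) h s = shuf w1 h s + shuf w2 h s.
Proof.
elim: s w1 w2 h => [|a s IH] w1 w2 h /=; first by rewrite mulrDl.
by rewrite contrD parD !IH addrACA.
Qed.

Lemma shufDr w h1 h2 s : shuf w (h1 \+ h2) s = shuf w h1 s + shuf w h2 s.
Proof.
elim: s w h1 h2 => [|a s IH] w h1 h2 /=; first by rewrite mulrDr.
by rewrite contrD !IH addrACA.
Qed.

Lemma shufZl c w h s : central c -> shuf (fun t => c * w t) h s =
  c * shuf w h s.
Proof.
move=> cC; elim: s w h => [|a s IH] w h /=; first by rewrite mulrA.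
by rewrite parZ // contrZ !IH mulrDr.
Qed.

Lemma shufZr c w h s : central c -> shuf w (fun t => c * h t) s =
  c * shuf w h s.
Proof.
move=> cC; elim: s w h => [|a s IH] w h /=; first by rewrite mulrA -cC mulrA.
by rewrite contrZ !IH mulrDr.
Qed.

Lemma shufNl w h s : shuf (\- w) h s = - shuf w h s.
Proof. by rewrite oppE shufZl ?mulN1r //; exact: centralN1. Qed.

Lemma shufNr w h s : shuf w (\- h) s = - shuf w h s.
Proof. by rewrite oppE shufZr ?mulN1r //; exact: centralN1. Qed.

Lemma shuf0 h s : shuf (fun=> 0) h s = 0.
Proof.
elim: s h => [|a s IH] h /=; first by rewrite mul0r.
have -> : par (fun=> 0) = fun=> 0 by apply/funext => t; rewrite /par mulr0.
by rewrite !IH addr0.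
Qed.

Variable P : V -> Prop.
Hypothesis (PD : forall x y, P x -> P y -> P (x + y)).
Hypothesis (PN : forall x, P x -> P (- x)).
Hypothesis (PM : forall x y, P x -> P y -> P (x * y)).

Lemma par_closed w : (forall s, P (w s)) -> forall s, P (par w s).
Proof. by move=> Pw s; rewrite /par -signr_odd mulr_sign; case: odd; auto. Qed.

Lemma shuf_closed w h : (forall s, P (w s)) -> (forall s, P (h s)) ->
  forall s, P (shuf w h s).
Proof.
move=> Pw Ph s; elim: s w h Pw Ph => [|a s IH] w h Pw Ph /=; first exact: PM.
by apply: PD; apply: IH => // t;
  first [exact: Pw | exact: Ph | exact: par_closed].
Qed.

End Shuffle.

Section Alternating.
Variable g : Type.

(** Only adjacent swaps, but after any prefix: a contraction lengthens the prefix, so the property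
    passes to contractions at once. *)
Definition alternating (V : zmodType) (w : seq g -> V) := forall s1 a b s2,
  w (s1 ++ a :: b :: s2) = - w (s1 ++ b :: a :: s2).

Lemma alt_contr (V : zmodType) a (w : seq g -> V) :
  alternating w -> alternating (contr a w).
Proof. by move=> aw s1; apply: aw (a :: s1). Qed.

Lemma alt_par (V : pzRingType) (w : seq g -> V) :
  alternating w -> alternating (par w).
Proof. by move=> aw s1 a b s2; rewrite /par aw !size_cat mulrN. Qed.

Lemma contrC (V : zmodType) a b (w : seq g -> V) : alternating w ->
  contr b (contr a w) = \- contr a (contr b w).
Proof. by move=> aw; apply/funext => s; apply: (aw [::]). Qed.

(** Contracting twice gives four terms. Two are antisymmetric because [w] and [h] are; the two mixed
    ones are exchanged, with opposite signs by [contr_par]. *)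
Lemma alt_shuf (V : pzRingType) (w h : seq g -> V) :
  alternating w -> alternating h -> alternating (shuf w h).
Proof.
move=> aw ah s1; elim: s1 w h aw ah => [|c s1 IH] w h aw ah a b s2 /=.
  rewrite !contr_par !shufNl !parK (contrC a b aw) (contrC a b ah).
  rewrite shufNl shufNr !opprD opprK.
  by rewrite addrACA.
rewrite (IH (contr c w) h) 1?(IH (par w) (contr c h)) ?opprD //;
  first [exact: alt_contr | exact: alt_par].
Qed.

End Alternating.

Section Multilinear.
Variables (R : pzRingType) (g : lmodType R) (V : pzRingType) (kappa : R -> V).
Hypothesis kappaC : forall k, central (kappa k).
Implicit Types (w h : seq g -> V) (s : seq g).

(** Scalars act through a central map [kappa], since V is only a ring; this covers operators as well
    as polynomials over them. *)
Definition multilin w := forall s1 k u v s2,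
  w (s1 ++ (k *: u + v) :: s2) = kappa k * w (s1 ++ u :: s2) + w (s1 ++ v ::
    s2).

Lemma multilin_contr a w : multilin w -> multilin (contr a w).
Proof. by move=> mw s1; apply: mw (a :: s1). Qed.

Lemma multilin_par w : multilin w -> multilin (par w).
Proof.
by move=> mw s1 k u v s2; rewrite /par mw mulrDr !size_cat /= !mulrA kappaC.
Qed.

Lemma multilin_shuf w h : multilin w -> multilin h -> multilin (shuf w h).
Proof.
move=> mw mh s1; elim: s1 w h mw mh => [|c s1 IH] w h mw mh k u v s2 /=.
  have cE (w' : seq g -> V) : multilin w' -> contr (k *: u + v) w' =
      (fun s => kappa k * contr u w' s) \+ contr v w'.
    by move=> mw'; apply/funext => s; apply: (mw' [::]).
  rewrite !cE // shufDl shufDr shufZl ?shufZr //.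
  by rewrite mulrDr addrACA.
have mc := @multilin_contr c; have mp := multilin_par mw.
rewrite (IH (contr c w) h (mc _ mw) mh) (IH (par w) (contr c h) mp (mc _ mh)).
by rewrite mulrDr addrACA.
Qed.

End Multilinear.

(** * The Chevalley-Eilenberg differential *)

Section Differential.
Variables (g : Type) (br : g -> g -> g).

Section Def.
Variables (V : zmodType) (act : g -> V -> V).
Implicit Types (w h : seq g -> V) (s : seq g).

(* the sum over i of w(.., [a, s_i], ..) *)
Fixpoint lie_br a w s : V :=
  if s is b :: s' then w (br a b :: s') + lie_br a (contr b w) s' else 0.

Definition lie a w : seq g -> V := fun s => act a (w s) - lie_br a w s.

(* Cartan's formula: iota_a d + d iota_a = L_a. *)
Fixpoint dif w s : V :=
  if s is a :: s' then lie a w s' - dif (contr a w) s' else 0.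

Lemma lie_brD a w h s : lie_br a (w \+ h) s = lie_br a w s + lie_br a h s.
Proof.
elim: s w h => [|b s IH] w h /=; first by rewrite addr0.
by rewrite contrD IH addrACA.
Qed.

Lemma lie_brN a w s : lie_br a (\- w) s = - lie_br a w s.
Proof.
elim: s w => [|b s IH] w /=; first by rewrite oppr0.
by rewrite contrN IH opprD.
Qed.

Hypothesis actB : forall a, {morph act a : x y / x - y}.

Lemma act0 a : act a 0 = 0.
Proof.
by rewrite -[in LHS](subrr 0) actB subrr.
Qed.
Lemma actN a x : act a (- x) = - act a x.
Proof.
by rewrite -sub0r actB act0 sub0r.
Qed.
Lemma actD a x y : act a (x + y) = act a x + act a y.
Proof. by rewrite -[y in LHS]opprK actB actN opprK. Qed.

Lemma difD w h s : dif (w \+ h) s = dif w s + dif h s.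
Proof.
elim: s w h => [|a s IH] w h /=; first by rewrite addr0.
rewrite contrD IH /lie /= actD lie_brD !opprD.
by rewrite (AC ((2*2)*2) ((1*3*5)*(2*4*6))).
Qed.

Lemma difN w s : dif (\- w) s = - dif w s.
Proof.
elim: s w => [|a s IH] w /=; first by rewrite oppr0.
by rewrite contrN IH /lie /= actN lie_brN !opprD.
Qed.

End Def.

Section Derivation.
Variables (V : pzRingType) (act : g -> V -> V).
Hypothesis actB : forall a, {morph act a : x y / x - y}.
Hypothesis actM : forall a x y, act a (x * y) = act a x * y + x * act a y.
Implicit Types (w h : seq g -> V) (s : seq g).

Lemma lie_br_par a w : lie_br a (par w) = par (lie_br a w).
Proof.
apply/funext => s; elim: s w => [|b s IH] w; first by rewrite /par /= mulr0.
by rewrite /= contr_par lie_brN IH /par /= exprS mulN1r mulrDr !mulNr.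
Qed.

Lemma lie_br_shuf a w h s :
  lie_br a (shuf w h) s = shuf (lie_br a w) h s + shuf w (lie_br a h) s.
Proof.
elim: s w h => [|b s IH] w h /=; first by rewrite mul0r mulr0 addr0.
rewrite -[contr b (shuf _ _)]/(shuf (contr b w) h \+ shuf (par w) (contr b h))
  lie_brD.
have cE w' : contr b (lie_br a w') = contr (br a b) w' \+ lie_br a (contr b w').
  by [].
rewrite !IH !cE shufDl shufDr lie_br_par.
by rewrite [LHS](AC (2*(2*2)) ((1*3*5)*(4*(2*6)))).
Qed.

Lemma act_shuf a w h s :
  act a (shuf w h s) = shuf (act a \o w) h s + shuf w (act a \o h) s.
Proof.
elim: s w h => [|b s IH] w h /=; first by rewrite actM.
have aE : act a \o par w = par (act a \o w).
  apply/funext => t; rewrite /par /= -signr_odd !mulr_sign.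
  by case: odd => //; rewrite (actN actB).
by rewrite (actD actB) !IH aE addrACA.
Qed.

Lemma lie_par a w : lie act a (par w) = par (lie act a w).
Proof.
apply/funext => s; rewrite /lie lie_br_par /par mulrBr; congr (_ - _).
by rewrite -signr_odd !mulr_sign; case: odd => //; rewrite (actN actB).
Qed.

Lemma lie_shuf a w h s :
  lie act a (shuf w h) s = shuf (lie act a w) h s + shuf w (lie act a h) s.
Proof.
rewrite /lie act_shuf lie_br_shuf.
have -> (w' : seq g -> V) : (fun s => act a (w' s) - lie_br a w' s) =
  (act a \o w') \+ \- lie_br a w' by [].
have -> : (fun s => act a (h s) - lie_br a h s) =
  (act a \o h) \+ \- lie_br a h by [].
by rewrite shufDl shufDr shufNl shufNr opprD addrACA.
Qed.

Lemma dif_par w : dif act (par w) = \- par (dif act w).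
Proof.
apply/funext => s; elim: s w => [|a s IH] w;
  first by rewrite /par /= mulr0 oppr0.
rewrite /= contr_par difN // IH lie_par /par /= exprS mulN1r.
by rewrite !mulNr ?opprK [in RHS]mulrBr.
Qed.

(** Contract both sides with the first argument: by Cartan's formula, [lie_shuf] (the Lie derivative
    is a derivation) and [dif_par], the claim reduces to the same one for the contracted
    cochains. *)
Lemma dif_shuf w h s :
  dif act (shuf w h) s = shuf (dif act w) h s + shuf (par w) (dif act h) s.
Proof.
elim: s w h => [|a s IH] w h /=; first by rewrite mul0r mulr0 addr0.
rewrite -[contr a (shuf _ _)]/(shuf (contr a w) h \+ shuf (par w) (contr a h))
  difD //.
have cE w' : contr a (dif act w') = lie act a w' \+ \- dif act (contr a w').
  by [].
rewrite !IH !cE lie_shuf dif_par parK contr_par !shufDl !shufDr !shufNl !shufNr.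
rewrite !opprD !opprK.
by rewrite [LHS](AC (2*(2*2)) ((1*3*5)*(4*(2*6)))).
Qed.

End Derivation.

(* Additivity is only assumed on P because Tr is 0 by convention on the
   operators which are not tensorial. *)
Lemma dif_natural (V W : zmodType) (actV : g -> V -> V) (actW : g -> W -> W)
  (P : V -> Prop) (f : V -> W) (w : seq g -> V) :
  (forall x y, P x -> P y -> P (x + y)) -> (forall x, P x -> P (- x)) -> P 0 ->
  (forall a x, P x -> P (actV a x)) ->
  (forall x y, P x -> P y -> f (x + y) = f x + f y) ->
  (forall a x, P x -> f (actV a x) = actW a (f x)) ->
  (forall s, P (w s)) ->
  forall s, P (dif actV w s) /\ f (dif actV w s) = dif actW (f \o w) s.
Proof.
move=> PD PN P0 Pact fD fact Pw.
have f0 : f 0 = 0 by apply: (@addrI _ (f 0)); rewrite -fD // !addr0.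
have fN x : P x -> f (- x) = - f x.
  by move=> Px; apply: (@addrI _ (f x)); rewrite -fD ?subrr //; exact: PN.
have brP a w' s : (forall s, P (w' s)) ->
    P (lie_br a w' s) /\ f (lie_br a w' s) = lie_br a (f \o w') s.
  elim: s w' => [|b s IH] w' Pw' //=.
  have [Pb fb] := IH (contr b w') (fun t => Pw' (b :: t)).
  by split; [apply: PD | rewrite fD // fb].
move=> s; elim: s w Pw => [|a s IH] w Pw //=.
have [Pd fd] := IH (contr a w) (fun t => Pw (a :: t)).
have [Pb fb] := brP a w s Pw.
have PB x y : P x -> P y -> P (x - y) by move=> Px Py; apply: PD => //;
  apply: PN.
have fB x y : P x -> P y -> f (x - y) = f x - f y.
  by move=> Px Py; rewrite fD ?fN //; apply: PN.
have Pl : P (lie actV a w s) by apply: PB => //; apply: Pact.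
split; first exact: PB.
by rewrite fB // fd /lie fB ?fb ?fact //; apply: Pact.
Qed.

End Differential.

(** * Bianchi identity and transgression *)

Section Ad.
Variable V : pzRingType.

Definition ad (x y : V) := x * y - y * x.

Lemma adB x : {morph ad x : y z / y - z}.
Proof.
by move=> y z; rewrite /ad mulrBr mulrBl !opprB [LHS](AC (2*2) ((1*4)*(3*2))).
Qed.

Lemma adC x y : ad x y = - ad y x.
Proof. by rewrite /ad opprB. Qed.

Lemma adBl x y z : ad (x - y) z = ad x z - ad y z.
Proof. by rewrite (adC _ z) adB (adC x) (adC y) opprB opprK addrC. Qed.

Lemma adM x y z : ad x (y * z) = ad x y * z + y * ad x z.
Proof. by rewrite /ad mulrBl mulrBr !mulrA addrA subrK. Qed.

Lemma ad_jacobi x y z : ad x (ad y z) = ad (ad x y) z + ad y (ad x z).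
Proof.
rewrite [in LHS]/(ad y z) adB !adM opprD.
by move: (ad x y) (ad x z) => p q; rewrite /ad [LHS](AC (2*2) ((1*4)*(2*3))).
Qed.

End Ad.

Section Degree.
Variables (g : Type) (br : g -> g -> g) (V : zmodType) (act : g -> V -> V).
Hypothesis actB : forall a, {morph act a : x y / x - y}.

Lemma lie_br0 a s : lie_br br a (fun=> 0 : V) s = 0.
Proof.
by elim: s => [|b s IH] //=; rewrite add0r -[contr b _]/(fun=> 0) IH.
Qed.

Lemma dif0 s : dif br act (fun=> 0) s = 0.
Proof.
elim: s => [|a s IH] //=.
by rewrite -[contr a _]/(fun=> 0) IH /lie lie_br0 (act0 actB) !subr0.
Qed.

(** With this, an identity between differentials of homogeneous cochains, such as [bianchi], has to
    be checked on lists of one length only. *)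
Lemma dif_deg n (w : seq g -> V) s : (forall t, size t != n -> w t = 0) ->
  size s != n.+1 -> dif br act w s = 0.
Proof.
have brE a (m : nat) (w' : seq g -> V) t :
    (forall t, size t != m -> w' t = 0) -> size t != m ->
    lie_br br a w' t = 0.
  elim: t m w' => [|b t IH] m w' w0 //= tm; rewrite w0 // add0r.
  case: m tm w0 => [|m] tm w0; last by apply: (IH m) => // t' t'm; apply: w0.
  have -> : contr b w' = fun=> 0 by apply/funext => t'; apply: w0.
  by rewrite lie_br0.
elim: s n w => [|a s IH] n w w0 //= sn.
rewrite /lie (brE _ n) // w0 // (act0 actB) subr0 sub0r.
case: n sn w0 => [|n] sn w0; last by rewrite (IH n) ?oppr0 // => t tn;
  apply: w0.
have -> : contr a w = fun=> 0 by apply/funext => t; apply: w0.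
by rewrite dif0 oppr0.
Qed.

End Degree.

Section ShufflePower.
Variables (g : Type) (V : pzRingType).
Implicit Types w : seq g -> V.

Lemma shufr0 w s : shuf w (fun=> 0) s = 0.
Proof.
elim: s w => [|a s IH] w /=; first by rewrite mulr0.
by rewrite -[contr a (fun=> 0)]/(fun=> 0) !IH addr0.
Qed.

Fixpoint shpow w n : seq g -> V :=
  if n is n'.+1 then shuf w (shpow w n') else unit_cochain V.

Lemma alt_shpow w n : alternating w -> alternating (shpow w n).
Proof.
move=> aw; elim: n => [|n IH] /=; last exact: alt_shuf.
by case=> [|c [|d s1]] a b s2; rewrite /= oppr0.
Qed.

Lemma dif_unit (br : g -> g -> g) (act : g -> V -> V) s :
  (forall a, {morph act a : x y / x - y}) -> (forall a, act a 1 = 0) ->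
  dif br act (unit_cochain V) s = 0.
Proof.
move=> actB act1; case: s => [|a s] //=; rewrite -[contr a _]/(fun=> 0) dif0 //.
rewrite subr0 /lie; case: s => [|b s] /=; first by rewrite act1 subr0.
by rewrite -[contr b _]/(fun=> 0) lie_br0 (act0 actB) addr0 subr0.
Qed.

Lemma dif_shpow (br : g -> g -> g) (act : g -> V -> V) w n s :
  (forall a, {morph act a : x y / x - y}) ->
  (forall a x y, act a (x * y) = act a x * y + x * act a y) ->
  (forall s, dif br act w s = 0) -> dif br act (shpow w n) s = 0.
Proof.
move=> actB actM dw; elim: n s => [|n IH] s /=.
  apply: dif_unit => // a; apply: (@addrI _ (act a 1)).
  by have := actM a 1 1; rewrite !mulr1 mul1r addr0.
rewrite dif_shuf //.
have -> : dif br act w = fun=> 0 by apply/funext.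
have -> : dif br act (shpow w n) = fun=> 0 by apply/funext.
by rewrite shuf0 shufr0 addr0.
Qed.

End ShufflePower.

Section Curvature.
Variables (g : zmodType) (br : g -> g -> g) (V : pzRingType) (D : g -> V).
Hypothesis DD : {morph D : a b / a + b}.
Hypothesis brC : forall a b, br a b = - br b a.
Hypothesis jac : forall a b c, br a (br b c) = br (br a b) c + br b (br a c).

Definition curv (s : seq g) : V :=
  if s is [:: a; b] then ad (D a) (D b) - D (br a b) else 0.

Lemma D0 : D 0 = 0.
Proof. by apply: (@addrI _ (D 0)); rewrite -DD !addr0. Qed.

Lemma DN a : D (- a) = - D a.
Proof. by apply: (@addrI _ (D a)); rewrite -DD !subrr D0. Qed.

Lemma alt_curv : alternating curv.
Proof.
case=> [|c [|d s1]] a b s2 /=; rewrite ?oppr0 //.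
  case: s2 => [|c s2]; rewrite ?oppr0 //.
  by rewrite (adC (D a)) (brC a) DN opprK [RHS]opprB addrC.
by case: s1 => [|e s1] /=; rewrite oppr0.
Qed.

Lemma bianchi s : dif br (fun a => ad (D a)) curv s = 0.
Proof.
have adDB a : {morph ad (D a) : x y / x - y} by exact: adB.
have [|s3] := eqVneq (size s) 3; last first.
  apply: (@dif_deg _ br _ (fun a => ad (D a)) adDB 2 _ _ _ s3).
  by case=> [|a [|b [|c t]]].
case: s => [|a [|b [|c [|d s]]]] //= _.
rewrite /lie /= /contr /= (jac a b c) DD !addr0 !subr0 !(adB _ (ad _ _))
  ad_jacobi.
rewrite (adC (D c) (ad _ _)) (adC (D c) (D (br a b))).
(* Both Jacobi identities have been applied; the commutators are now atoms, and a cancellation in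
   the additive group remains. *)
move: (ad (ad _ _) _) (ad (D b) (ad _ _)) (ad (D a) (D (br b c))) => P Q X.
move: (ad (D (br a b)) (D c)) (ad (D b) (D (br a c))) => U Y.
move: (D _) (D _) => p q; apply/eqP; rewrite subr_eq0.
rewrite !opprB !opprD !opprK.
by rewrite [X in _ == X](AC (2*3*2) ((7*1*5)*((6*3)*(2*4)))).
Qed.

End Curvature.

Lemma shuf_natural (g : Type) (V W : pzRingType) (f : V -> W)
  (w h : seq g -> V) s : {morph f : x y / x - y} -> {morph f : x y / x * y} ->
  f (shuf w h s) = shuf (f \o w) (f \o h) s.
Proof.
move=> fB fM; have f0 : f 0 = 0 by rewrite -[in LHS](subrr 0) fB subrr.
have fN x : f (- x) = - f x by rewrite -sub0r fB f0 sub0r.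
have fD x y : f (x + y) = f x + f y by rewrite -[y in LHS]opprK fB fN opprK.
elim: s w h => [|a s IH] w h /=; first by rewrite fM.
rewrite fD !IH; congr (_ + shuf _ _ _).
apply/funext => t; rewrite /par /= -signr_odd -[in RHS]signr_odd !mulr_sign.
by case: odd.
Qed.

Lemma shpow_natural (g : Type) (V W : pzRingType) (f : V -> W)
  (w : seq g -> V) n s : {morph f : x y / x - y} -> {morph f : x y / x * y} ->
  f 1 = 1 -> f (shpow w n s) = shpow (f \o w) n s.
Proof.
move=> fB fM f1; have f0 : f 0 = 0 by rewrite -[in LHS](subrr 0) fB subrr.
elim: n s => [|n IH] s /=; first by case: s.
by rewrite shuf_natural //; congr (shuf _ _ _); apply/funext.
Qed.

Section Transgression.
Variables (g : zmodType) (br : g -> g -> g) (V : pzRingType) (D B : g -> V).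
Variable delta : V -> V.
Hypothesis DD : {morph D : a b / a + b}.
Hypothesis brC : forall a b, br a b = - br b a.
Hypothesis jac : forall a b c, br a (br b c) = br (br a b) c + br b (br a c).
Hypothesis deltaB : {morph delta : x y / x - y}.
Hypothesis deltaM : forall x y, delta (x * y) = delta x * y + x * delta y.
Hypothesis deltaD : forall a, delta (D a) = B a.

Let act a := ad (D a).
Let actB a : {morph act a : x y / x - y}. Proof. exact: adB. Qed.
Let actM a x y : act a (x * y) = act a x * y + x * act a y.
Proof. exact: adM. Qed.

Definition cochain1 (s : seq g) : V := if s is [:: a] then B a else 0.

(* Q_p in the notation of the header *)
Fixpoint transg p : seq g -> V :=
  if p is p'.+1 then
    shuf (curv br D) (transg p') \+ shuf cochain1 (shpow (curv br D) p')
  else fun=> 0.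

Lemma alt_cochain1 : alternating cochain1.
Proof. by case=> [|c [|d s1]] a b s2; rewrite /= oppr0. Qed.

Lemma alt_transg p : alternating (transg p).
Proof.
elim: p => [|p IH] /=; first by move=> *; rewrite oppr0.
have aR : alternating (curv br D) := alt_curv DD brC.
move=> s1 a b s2 /=; rewrite opprD; congr (_ + _); first exact: alt_shuf.
by apply: alt_shuf; [exact: alt_cochain1 | exact: alt_shpow].
Qed.

Lemma delta_curv s : delta (curv br D s) = dif br act cochain1 s.
Proof.
have delta0 : delta 0 = 0 by rewrite -[in LHS](subrr 0) deltaB subrr.
have [|s2] := eqVneq (size s) 2; last first.
  rewrite (@dif_deg _ br _ act actB 1 _ _ _ s2) => [|[|a [|b t]]] //.
  by case: s s2 => [|a [|b [|c s]]].
case: s => [|a [|b [|c s]]] //= _.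
rewrite /lie /= /contr /= !addr0 !subr0 /act -adC deltaB deltaD.
have -> : delta (ad (D a) (D b)) = ad (B a) (D b) + ad (D a) (B b).
  rewrite /ad deltaB !deltaM !deltaD opprD.
  by rewrite [LHS](AC (2*2) ((1*4)*(2*3))).
by rewrite [RHS]addrC [RHS]addrA.
Qed.

Lemma par_curv : par (curv br D) = curv br D.
Proof.
apply/funext => -[|a [|b [|c s]]]; rewrite /par /= ?mulr0 //.
by rewrite expr2 mulrNN mulr1 mul1r.
Qed.

(** By Bianchi, d kills R and R^p, and R has even degree; so d(R Q_p + B R^p) = R dQ_p + (dB) R^p.
    With [delta_curv] and the induction hypothesis this is the Leibniz rule of [delta] on R R^p. *)
Lemma dif_transg p s :
  dif br act (transg p) s = delta (shpow (curv br D) p s).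
Proof.
have delta0 : delta 0 = 0 by rewrite -[in LHS](subrr 0) deltaB subrr.
elim: p s => [|p IH] s /=.
  rewrite dif0 //; case: s => //=; apply: (@addrI _ (delta 1)).
  by have := deltaM 1 1; rewrite !mulr1 mul1r addr0.
rewrite (difD _ actB) !dif_shuf // par_curv.
have -> : delta (shuf (curv br D) (shpow (curv br D) p) s) =
    shuf (delta \o curv br D) (shpow (curv br D) p) s +
    shuf (curv br D) (delta \o shpow (curv br D) p) s.
  (* The action here is [delta] for every index, and [0] is a dummy index. *)
  exact: (@act_shuf _ _ (fun=> delta) (fun=> deltaB) (fun=> deltaM) (0 : g)).
have -> : dif br act (curv br D) = fun=> 0.
  by apply/funext => t; exact: bianchi.
have -> : dif br act (shpow (curv br D) p) = fun=> 0.
  by apply/funext => t; apply: dif_shpow => // t'; exact: bianchi.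
rewrite shuf0 shufr0 add0r addr0 addrC.
congr (_ + _); congr (shuf _ _ _).
  by apply/funext => t; rewrite /= delta_curv.
by apply/funext => t; rewrite IH.
Qed.

End Transgression.

(** * Chern forms over a ring with a partially defined trace *)

Section ChernForms.
Variables (R : numFieldType) (g : lmodType R) (br : g -> g -> g).
Variables (C : lmodType R) (actC : g -> C -> C).
Hypothesis brD : forall k a b c, br (k *: a + b) c = k *: br a c + br b c.
Hypothesis brC : forall a b, br a b = - br b a.
Hypothesis jac : forall a b c, br a (br b c) = br (br a b) c + br b (br a c).
Hypothesis actCP : forall a k x y,
  actC a (k *: x + y) = k *: actC a x + actC a y.

(* The tame elements are those on which the trace behaves well: the tensorial
   operators. *)
Record trace_data (V : pzRingType) := TraceData {
  tr : V -> C;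
  tame : V -> Prop;
  scal : R -> V;
  tame1 : tame 1;
  tameB : forall x y, tame x -> tame y -> tame (x - y);
  tameM : forall x y, tame x -> tame y -> tame (x * y);
  tame_scal : forall k, tame (scal k);
  scal1 : scal 1 = 1;
  scalC : forall k, central (scal k);
  trD : forall x y, tame x -> tame y -> tr (x + y) = tr x + tr y;
  tr_scal : forall k x, tame x -> tr (scal k * x) = k *: tr x }.

Section TraceTheory.
Variables (V : pzRingType) (T : trace_data V).

Lemma tame0 : tame T 0.
Proof. by rewrite -(subrr 1); apply: tameB; apply: tame1. Qed.
Lemma tameN x : tame T x -> tame T (- x).
Proof. by move=> Px; rewrite -sub0r; apply: tameB => //; apply: tame0. Qed.
Lemma tameD x y : tame T x -> tame T y -> tame T (x + y).
Proof. by move=> Px Py; rewrite -[y]opprK; apply/tameB/tameN. Qed.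
Lemma tr0 : tr T 0 = 0.
Proof. by apply: (@addrI _ (tr T 0)); rewrite -trD ?addr0 //; apply: tame0. Qed.
Lemma trN x : tame T x -> tr T (- x) = - tr T x.
Proof.
move=> Px; apply: (@addrI _ (tr T x)).
by rewrite -trD ?subrr ?tr0 //; apply: tameN.
Qed.
Lemma trB x y : tame T x -> tame T y -> tr T (x - y) = tr T x - tr T y.
Proof. by move=> Px Py; rewrite trD ?trN //; apply: tameN. Qed.

Lemma tame_sum n (F : 'I_n -> V) : (forall i, tame T (F i)) ->
  tame T (\sum_i F i) /\ tr T (\sum_i F i) = \sum_i tr T (F i).
Proof.
elim: n F => [|n IH] F PF; first by rewrite !big_ord0 tr0; split=> //;
  apply: tame0.
have [P1 E1] := IH (fun i => F (lift ord0 i)) (fun i => PF _).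
rewrite !big_ord_recl; split; first exact: tameD.
by rewrite trD // E1.
Qed.

Lemma tame_mulrn x n : tame T x -> tame T (x *+ n) /\ tr T (x *+ n) =
  tr T x *+ n.
Proof.
move=> Px; elim: n => [|n [P1 E1]]; first by rewrite !mulr0n tr0; split=> //;
  apply: tame0.
by rewrite !mulrS trD // E1; split=> //; apply: tameD.
Qed.

Lemma tame_shpow (w : seq g -> V) n : (forall s, tame T (w s)) ->
  forall s, tame T (shpow w n s).
Proof.
move=> Pw; elim: n => [|n IH] s /=.
  by case: s => [|a s] /=; [apply: tame1 | apply: tame0].
by apply: shuf_closed => //; [exact: tameD | exact: tameN | exact: tameM].
Qed.

Lemma multilin_tr (w : seq g -> V) : (forall s, tame T (w s)) ->
  multilin (scal T) w -> forall s1 k u v s2,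
  tr T (w (s1 ++ (k *: u + v) :: s2)) =
  k *: tr T (w (s1 ++ u :: s2)) + tr T (w (s1 ++ v :: s2)).
Proof.
move=> Pw mw s1 k u v s2; rewrite mw trD ?tr_scal //.
by apply: tameM => //; apply: tame_scal.
Qed.

(** The [D a] need not be tame. What connects them with the trace is the third clause, the abstract
    form of Tr [D_a, T] = rho(a)(Tr T). *)
Definition tr_conn (D : g -> V) :=
  [/\ forall k a b, D (k *: a + b) = scal T k * D a + D b,
      forall a x, tame T x -> tame T (ad (D a) x),
      forall a x, tame T x -> tr T (ad (D a) x) = actC a (tr T x) &
      forall s, tame T (curv br D s)].

Lemma tr_connD D : tr_conn D -> {morph D : a b / a + b}.
Proof.
by case=> Dlin _ _ _ a b; have := Dlin 1 a b; rewrite scale1r scal1 mul1r.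
Qed.

Lemma brDr k a b c : br c (k *: a + b) = k *: br c a + br c b.
Proof. by rewrite brC brD opprD -scalerN -!brC. Qed.

Lemma multilin_curv D : tr_conn D -> multilin (scal T) (curv br D).
Proof.
case=> Dlin _ _ _.
have adl k x y z : ad (scal T k * x + y) z = scal T k * ad x z + ad y z.
  rewrite /ad mulrDl mulrDr opprD addrACA mulrA; congr (_ + _).
  by rewrite mulrBr !mulrA (scalC T k z).
have adr k x y z : ad z (scal T k * x + y) = scal T k * ad z x + ad z y.
  by rewrite adC adl opprD -mulrN -!adC.
case=> [|c [|d s1]] k u v s2 /=.
- case: s2 => [|e [|f s2]]; rewrite ?mulr0 ?addr0 //.
  by rewrite Dlin adl brD Dlin opprD addrACA -mulrN -mulrDr.
- case: s2 => [|e s2]; last by rewrite mulr0 addr0.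
  by rewrite Dlin adr brDr Dlin opprD addrACA -mulrN -mulrDr.
by case: s1 => [|e s1] /=; rewrite mulr0 addr0.
Qed.

Lemma dif_tr D (w : seq g -> V) s : tr_conn D -> (forall s, tame T (w s)) ->
  dif br actC (fun t => tr T (w t)) s =
  tr T (dif br (fun a => ad (D a)) w s).
Proof.
case=> _ Pad trad _ Pw.
have [_ <- //] := @dif_natural _ br _ _ (fun a => ad (D a)) actC (tame T) (tr T)
  w tameD tameN tame0 Pad (@trD _ T) trad Pw s.
Qed.

Definition chern D p (s : seq g) := tr T (shpow (curv br D) p s).

Lemma alt_chern D p : tr_conn D -> alternating (chern D p).
Proof.
move=> cD s1 a b s2; have tw := tame_shpow p (let: And4 _ _ _ h := cD in h).
rewrite -trN //; congr (tr T _); apply: alt_shpow.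
by apply: alt_curv; [exact: tr_connD | exact: brC].
Qed.

Lemma multilin_unit : multilin (scal T) (unit_cochain V : seq g -> V).
Proof.
by case=> [|c s1] k u v s2; rewrite /= mulr0 addr0.
Qed.

Lemma multilin_shpow (w : seq g -> V) p :
  multilin (scal T) w -> multilin (scal T) (shpow w p).
Proof.
move=> mw; elim: p => [|p IH]; first exact: multilin_unit.
by apply: multilin_shuf => //; exact: scalC.
Qed.

Lemma multilin_chern D p : tr_conn D -> forall s1 k u v s2,
  chern D p (s1 ++ (k *: u + v) :: s2) =
  k *: chern D p (s1 ++ u :: s2) + chern D p (s1 ++ v :: s2).
Proof.
move=> cD; have tw := tame_shpow p (let: And4 _ _ _ h := cD in h).
by apply: multilin_tr => //; apply/multilin_shpow/multilin_curv.
Qed.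

Lemma dif_chern D p s : tr_conn D -> dif br actC (chern D p) s = 0.
Proof.
move=> cD; have tw := tame_shpow p (let: And4 _ _ _ h := cD in h).
rewrite (dif_tr _ cD tw) dif_shpow ?tr0 // => [a|a x y|t].
- exact: adB.
- exact: adM.
by apply: bianchi => //; exact: tr_connD.
Qed.

End TraceTheory.

(** * The segment between two connections and its Chern-Simons form *)

Section Homotopy.
Variables (V : nzRingType) (T : trace_data V) (D D' : g -> V).
Hypotheses (cD : tr_conn T D) (cD' : tr_conn T D').
Hypothesis tameDD' : forall a, tame T (D' a - D a).

Definition ptame (q : {poly V}) := forall k, tame T q`_k.

(* the integral over [0, 1] of the coefficientwise trace *)
Definition ptr (q : {poly V}) : C :=
  \sum_(k < size q) (k.+1%:R)^-1 *: tr T q`_k.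

Lemma ptrE n (q : {poly V}) : (size q <= n)%N ->
  ptr q = \sum_(k < n) (k.+1%:R)^-1 *: tr T q`_k.
Proof.
move=> qn; rewrite /ptr (big_ord_widen n (fun k => (k.+1%:R)^-1 *: tr T q`_k)) //.
rewrite big_mkcond; apply: eq_bigr => k _; case: ltnP => // qk.
by rewrite nth_default // tr0 scaler0.
Qed.

Fact ptame1 : ptame 1.
Proof.
by move=> k; rewrite coef1; case: eqP => _; [apply: tame1|apply: tame0].
Qed.
Fact ptameB x y : ptame x -> ptame y -> ptame (x - y).
Proof. by move=> Px Py k; rewrite coefB; apply: tameB. Qed.
Fact ptameM x y : ptame x -> ptame y -> ptame (x * y).
Proof.
by move=> Px Py k; rewrite coefM; apply: (tame_sum _).1 => i; apply: tameM.
Qed.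
Fact ptameC x : tame T x -> ptame x%:P.
Proof. by move=> Px k; rewrite coefC; case: eqP => // _; apply: tame0. Qed.
Fact pscalC k : central (scal T k)%:P.
Proof.
move=> q; apply/polyP => i; rewrite coefCM coefMC; exact: scalC.
Qed.
Fact ptrD x y : ptame x -> ptame y -> ptr (x + y) = ptr x + ptr y.
Proof.
move=> Px Py; pose n := maxn (size x) (size y).
rewrite (ptrE (size_polyD x y)) (@ptrE n x) ?leq_maxl // (@ptrE n y) ?leq_maxr //.
by rewrite -big_split; apply: eq_bigr => k _; rewrite coefD trD // scalerDr.
Qed.
Fact ptr_scal k q : ptame q -> ptr ((scal T k)%:P * q) = k *: ptr q.
Proof.
move=> Pq; have le : (size ((scal T k)%:P * q)%R <= size q)%N.
  by rewrite mul_polyC size_scale_leq.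
rewrite (ptrE le) scaler_sumr; apply: eq_bigr => i _.
by rewrite coefCM tr_scal // !scalerA mulrC.
Qed.

(** A trace is only asked to be additive and compatible with scalars, so its integral over t is
    again one. The theory above thus applies to the family D_t as to a single connection. *)
Definition poly_trace : trace_data {poly V} :=
  @TraceData _ ptr ptame (fun k => (scal T k)%:P) ptame1 ptameB ptameM
    (fun k => ptameC (tame_scal T k)) (congr1 polyC (scal1 T)) pscalC ptrD
      ptr_scal.

Let B a := D' a - D a.
Definition segment a : {poly V} := (D a)%:P + 'X * (B a)%:P.

Lemma coef_segment a k : (segment a)`_k =
  if k is k'.+1 then if k' == 0%N then B a else 0 else D a.
Proof.
rewrite coefD coefC coefXM coefC; case: k => [|k] /=; first by rewrite addr0.
by rewrite add0r.
Qed.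

Lemma coef_ad_segment a q k : (ad (segment a) q)`_k =
  ad (D a) q`_k + (if k is k'.+1 then ad (B a) q`_k' else 0).
Proof.
rewrite /ad /segment mulrDl mulrDr -(mulrA 'X) (mulrA q) (commr_polyX q)
  -(mulrA 'X).
rewrite coefB !coefD !coefXM !coefCM !coefMC.
case: k => [|k] /=; first by rewrite !addr0.
by rewrite opprD addrACA.
Qed.

(** Both connections induce the same [actC a] on traces, and it cancels in their difference. *)
Lemma trB0 a x : tame T x -> tame T (ad (B a) x) /\ tr T (ad (B a) x) = 0.
Proof.
have [_ t1 tr1 _] := cD; have [_ t2 tr2 _] := cD'.
move=> Px; have -> : ad (B a) x = ad (D' a) x - ad (D a) x.
  by rewrite adBl.
rewrite trB; auto; split; first by apply: tameB; auto.
by rewrite tr1 // tr2 // subrr.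
Qed.

Lemma ptame_segment a q : ptame q -> ptame (ad (segment a) q).
Proof.
have [_ t1 _ _] := cD; move=> Pq k; rewrite coef_ad_segment.
apply: tameD; first exact: t1.
by case: k => [|k]; [apply: tame0 | apply: (trB0 _ _).1].
Qed.

Lemma size_ad_segment a q : (size (ad (segment a) q) <= (size q).+1)%N.
Proof.
apply/leq_sizeP => k qk; rewrite coef_ad_segment.
have ad0 x : ad x 0 = 0 :> V by rewrite /ad mulr0 mul0r subr0.
case: k qk => [|k] //; rewrite ltnS => qk.
by rewrite !nth_default ?ad0 ?addr0 // leqW.
Qed.

(** The summand t B of the segment contributes only coefficients of trace 0, by [trB0]; what is left
    is the rule for D, coefficient by coefficient. *)
Lemma ptr_segment a q : ptame q -> ptr (ad (segment a) q) = actC a (ptr q).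
Proof.
have [_ t1 tr1 _] := cD; move=> Pq.
have actC0 : actC a 0 = 0.
  have := actCP a 1 0 0; rewrite !scale1r addr0 => h.
  by apply: (@addrI _ (actC a 0)); rewrite -h addr0.
have actCs n (F : 'I_n -> C) (c : 'I_n -> R) :
    actC a (\sum_i c i *: F i) = \sum_i c i *: actC a (F i).
  elim: n F c => [|n IH] F c; first by rewrite !big_ord0.
  by rewrite !big_ord_recl actCP (IH (fun i => F (lift ord0 i))).
(* The commutator with the segment may raise the degree by one, so both sums are extended to the
   bound [(size q).+1]. *)
rewrite (ptrE (size_ad_segment a q)) (ptrE (leqnSn (size q))) actCs.
apply: eq_bigr => k _; congr (_ *: _); rewrite coef_ad_segment -tr1 //.
rewrite trD; [|exact: t1|]; last first.
  by case: (k : nat) => [|k']; [apply: tame0 | apply: (trB0 _ _).1].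
suff -> : tr T (if k : nat is k'.+1 then ad (B a) q`_k' else 0) = 0.
  by rewrite addr0.
by case: (k : nat) => [|k']; [apply: tr0 | apply: (trB0 _ _).2].
Qed.

Lemma segment_linear k a b :
  segment (k *: a + b) = (scal T k)%:P * segment a + segment b.
Proof.
have [l1 _ _ _] := cD; have [l2 _ _ _] := cD'.
apply/polyP => i; rewrite [in RHS]coefD coefCM !coef_segment.
case: i => [|[|i]] //=; last by rewrite mulr0 addr0.
by rewrite /B l1 l2 mulrBr opprD addrACA.
Qed.

Lemma segment_conn : tr_conn poly_trace segment.
Proof.
split; [exact: segment_linear | exact: ptame_segment | exact: ptr_segment |].
have [_ t1 _ tR] := cD.
case=> [|a [|b [|c s]]] //; try by move=> k; rewrite coef0; apply: tame0.
move=> k; rewrite /curv coefB coef_ad_segment !coef_segment.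
(* The coefficients of R_t are the curvature of D, then [D_a, B_b] + [B_a, D_b] - B_[a,b], then
   [B_a, B_b], and 0 beyond. *)
case: k => [|[|k]] /=.
- by rewrite addr0; apply: (tR [:: a; b]).
- apply: tameB; last exact: tameDD'.
  apply: tameD; first exact/t1/tameDD'.
  by rewrite coef_segment adC; apply: tameN; apply: t1; apply: tameDD'.
- rewrite subr0; apply: tameD.
    by apply: t1; apply: tame0.
  rewrite coef_segment; apply: (trB0 _ _).1.
  by case: k => [|k]; [exact: tameDD' | exact: tame0].
Qed.

Definition chern_simons p (s : seq g) : C :=
  ptr (transg br segment (fun a => (B a)%:P) p s).

Lemma ptame_transg p s :
  ptame (transg br segment (fun a => (B a)%:P) p s).
Proof.
have [_ _ _ tR] := segment_conn.
elim: p s => [|p IH] s /=; first exact: (tame0 poly_trace).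
have tB t : ptame (cochain1 (fun a => (B a)%:P) t).
  case: t => [|a [|b t]] /=; try exact: (tame0 poly_trace).
  exact/ptameC/tameDD'.
apply: (@tameD _ poly_trace); apply: (shuf_closed (P := ptame)) => //;
  first [exact: (@tameD _ poly_trace) | exact: (@tameN _ poly_trace)
        | exact: ptameM | exact: (tame_shpow (T := poly_trace))].
Qed.

Lemma alt_chern_simons p : alternating (chern_simons p).
Proof.
move=> s1 a b s2; rewrite -(trN (T := poly_trace)); last exact: ptame_transg.
congr (ptr _); apply: alt_transg => //.
exact: (tr_connD segment_conn).
Qed.

Lemma multilin_chern_simons p s1 k u v s2 :
  chern_simons p (s1 ++ (k *: u + v) :: s2) =
  k *: chern_simons p (s1 ++ u :: s2) + chern_simons p (s1 ++ v :: s2).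
Proof.
apply: (@multilin_tr _ poly_trace) => [s|]; first exact: ptame_transg.
have mR := multilin_curv segment_conn.
elim: p => [|p IH] /=; first by move=> *; rewrite mulr0 addr0.
have mS := multilin_shuf (@pscalC) mR IH.
have mB : multilin (scal poly_trace) (cochain1 (fun a => (B a)%:P)).
  case=> [|c [|d s]] l x y [|e t] /=; rewrite ?mulr0 ?addr0 //.
  have [l1 _ _ _] := cD; have [l2 _ _ _] := cD'.
  by rewrite -polyCM -polyCD /B l1 l2 mulrBr opprD addrACA.
have mT := multilin_shuf (@pscalC) mB (multilin_shpow (T := poly_trace) p mR).
by move=> r1 l x y r2 /=; rewrite mS mT mulrDr addrACA.
Qed.

(** The fundamental theorem of calculus: the factor k + 1 from differentiating t^(k+1) cancels the
    weight in [ptr]. Evaluation at 1 sums all coefficients, evaluation at 0 keeps the constant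
    one. *)
Lemma ptr_deriv q : ptame q -> ptr q^`() = tr T q.[1] - tr T q.[0].
Proof.
move=> Pq; have le : (size q^`() <= (size q).-1)%N.
  apply/leq_sizeP => k qk; rewrite coef_deriv nth_default ?mul0rn //.
  by rewrite -ltnS in qk; apply: leq_trans (leqSpred _) qk.
have [q0|q_gt0] := posnP (size q).
  have -> : q = 0 by apply/eqP; rewrite -size_poly_eq0 q0.
  by rewrite deriv0 !horner0 subrr /ptr size_poly0 big_ord0.
have E n : size q = n.+1 -> tr T q.[1] = tr T q`_0 + \sum_(k < n) tr T q`_k.+1.
  move=> qn; rewrite horner_coef qn big_ord_recl expr0 mulr1 trD //; last first.
    by apply: (tame_sum _).1 => i; rewrite expr1n mulr1.
  rewrite (tame_sum _).2 => [|i]; last by rewrite expr1n mulr1.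
  by congr (_ + _); apply: eq_bigr => i _; rewrite expr1n mulr1.
rewrite (E (size q).-1) ?prednK // horner_coef0 addrAC subrr add0r (ptrE le).
apply: eq_bigr => k _; rewrite coef_deriv (tame_mulrn _ _).2 //.
by rewrite -(scaler_nat _ (tr T _)) scalerA mulVf ?scale1r // pnatr_eq0.
Qed.

Lemma dif_chern_simons p s :
  dif br actC (chern_simons p) s = chern T D' p s - chern T D p s.
Proof.
rewrite (dif_tr _ segment_conn) => [|t]; last exact: ptame_transg.
rewrite (dif_transg (delta := @deriv V)) //; last first.
- by move=> a; rewrite /segment derivD derivM derivC derivX mul1r derivC mulr0
  add0r addr0.
- exact: derivM.
- exact: derivB.
- exact: (tr_connD segment_conn).
have [_ _ _ tR] := segment_conn.
rewrite (_ : tr poly_trace = ptr) // ptr_deriv;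
  last exact: (tame_shpow (T := poly_trace)).
(* Over a noncommutative V, evaluation at c is multiplicative only for central c; the end points 0
   and 1 are central. *)
have hM (c : V) : (forall x, GRing.comm c x) ->
    {morph (fun q : {poly V} => q.[c]) : x y / x * y}.
  by move=> cC x y; apply: hornerM_comm; exact: cC.
have hB (c : V) : {morph (fun q : {poly V} => q.[c]) : x y / x - y}.
  by move=> x y; rewrite !hornerE.
have h1 (c : V) : (1 : {poly V}).[c] = 1 by rewrite hornerC.
have hR c (D1 : g -> V) : (forall x, GRing.comm c x) ->
    (forall a, (segment a).[c] = D1 a) ->
    (fun q : {poly V} => q.[c]) \o curv br segment = curv br D1.
  move=> cC h; apply/funext => -[|a [|b [|d t]]] /=; rewrite ?horner0 //.
  by rewrite /ad hB hB !hM // !h.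
have c1 x : GRing.comm (1 : V) x by apply: commr_sym; apply: commr1.
have c0 x : GRing.comm (0 : V) x by apply: commr_sym; apply: commr0.
congr (tr T _ - tr T _).
- rewrite (shpow_natural (f := fun q : {poly V} => q.[1])) //; last exact: hM.
  rewrite (hR 1 D') // => a.
  by rewrite /segment hornerD hornerC hM // hornerX hornerC mul1r /B addrC
    subrK.
- rewrite (shpow_natural (f := fun q : {poly V} => q.[0])) //; last exact: hM.
  rewrite (hR 0 D) // => a.
  by rewrite /segment hornerD hornerC hM // hornerX mul0r addr0.
Qed.

End Homotopy.

(* The ring V may be trivial, hence without polynomials. *)
Lemma transgression (V : pzRingType) (T : trace_data V) (D D' : g -> V) p :
  tr_conn T D -> tr_conn T D' -> (forall a, tame T (D' a - D a)) ->
  exists th : seq g -> C,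
    [/\ alternating th,
        forall s1 k u v s2, th (s1 ++ (k *: u + v) :: s2) =
          k *: th (s1 ++ u :: s2) + th (s1 ++ v :: s2) &
        forall s, dif br actC th s = chern T D' p s - chern T D p s].
Proof.
have [V0|V1] := eqVneq (1 : V) 0; last first.
  (* destructing V makes W and V convertible as rings *)
  move: V1 T D D'; case: V => V [m1 m2 m3 m4 m5 m6 m7 m8 m9 m10] V1.
  pose P : pzRingType := @GRing.PzRing.Pack V
    (@GRing.PzRing.Class V m1 m2 m3 m4 m5 m6 m7 m8 m9 m10).
  pose W : nzRingType := HB.pack P (GRing.PzSemiRing_isNonZero.Build P V1).
  move=> T D D' cD cD' tDD'; exists (@chern_simons W T D D' p); split.
  - exact: (@alt_chern_simons W T D D').
  - exact: (@multilin_chern_simons W T D D').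
  - exact: (@dif_chern_simons W T D D').
move=> cD cD' tDD'.
have triv (x y : V) : x = y by rewrite -[x]mulr1 -[y]mulr1 V0 !mulr0.
have actCB a : {morph actC a : x y / x - y}.
  by move=> x y; rewrite -scaleN1r addrC actCP scaleN1r addrC.
exists (fun=> 0); split=> [s1 a b s2|s1 k u v s2|s].
- by rewrite oppr0.
- by rewrite scaler0 addr0.
- by rewrite dif0 // /chern (triv (shpow _ _ _) 0) (triv (shpow (curv br D) _
  _) 0) subrr.
Qed.

End ChernForms.

(** * Antisymmetrization *)

Section Antisymmetrization.
Variable g : Type.

Section Zmod.
Variable V : zmodType.
Implicit Types (w h F G : seq g -> V) (s : seq g).

(** The signed sum of F over all places where b can be inserted ([ins_sum]). Inserting the arguments
    one after another, [asym] runs through all permutations ([asym_perm]). *)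
Fixpoint ins b F s : V :=
  if s is a :: s' then F [:: b, a & s'] - ins b (contr a F) s' else F [:: b].

Fixpoint asym F s : V := if s is a :: s' then asym (ins a F) s' else F [::].

Definition insert (k : nat) (b : g) s := take k s ++ b :: drop k s.

Lemma insD b F G : ins b (F \+ G) = ins b F \+ ins b G.
Proof.
apply/funext => s; elim: s F G => [|a s IH] F G //=.
by rewrite contrD IH /= opprD addrACA.
Qed.

Lemma insN b F : ins b (\- F) = \- ins b F.
Proof.
apply/funext => s; elim: s F => [|a s IH] F //=.
by rewrite contrN IH /= opprB opprK addrC.
Qed.

Lemma asymD F G s : asym (F \+ G) s = asym F s + asym G s.
Proof. by elim: s F G => [|a s IH] F G //=; rewrite insD IH. Qed.

Lemma asymN F s : asym (\- F) s = - asym F s.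
Proof. by elim: s F => [|a s IH] F //=; rewrite insN IH. Qed.

Lemma ins_mulrn b F (c : nat -> nat) s :
  ins b (fun t => F t *+ c (size t)) s = ins b F s *+ c (size s).+1.
Proof.
elim: s F c => [|a s IH] F c //=.
by rewrite mulrnBl -(IH (contr a F) (fun n => c n.+1)).
Qed.

Lemma asym_mulrn F (c : nat -> nat) s :
  asym (fun t => F t *+ c (size t)) s = asym F s *+ c (size s).
Proof.
elim: s F c => [|a s IH] F c //=; rewrite -(IH _ (fun n => c n.+1)).
by congr (asym _ _); apply/funext => t; rewrite ins_mulrn.
Qed.

(** Moving b to the front past k entries costs (-1)^k, which is the sign of that insertion; so all
    insertions agree. *)
Lemma ins_alt b w s : alternating w -> ins b w s = w (b :: s) *+ (size s).+1.
Proof.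
elim: s w => [|a s IH] w aw //=.
rewrite IH; last exact: alt_contr.
by rewrite /contr (aw [::] a b s) /= mulNrn opprK [RHS]mulrS.
Qed.

Lemma asym_alt w s : alternating w -> asym w s = w s *+ (size s)`!.
Proof.
elim: s w => [|a s IH] w aw //=.
have -> : ins a w = fun t => contr a w t *+ (size t).+1.
  by apply/funext => t; rewrite ins_alt.
rewrite (asym_mulrn _ (fun n => n.+1)) IH; last exact: alt_contr.
by rewrite -mulrnA factS mulnC.
Qed.

End Zmod.

Section Ring.
Variable V : pzRingType.
Implicit Types (w h F G : seq g -> V) (s : seq g).

Lemma ins_sum b F s :
  ins b F s = \sum_(k < (size s).+1) (-1) ^+ k * F (insert k b s).
Proof.
elim: s F => [|a s IH] F /=; first by rewrite big_ord1 mul1r.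
rewrite big_ord_recl mul1r IH; congr (_ + _).
by rewrite -sumrN; apply: eq_bigr => k _; rewrite exprS mulN1r mulNr.
Qed.

(* the deconcatenation product *)
Fixpoint ten F G s : V :=
  if s is a :: s' then F [::] * G s + ten (contr a F) G s'
  else F [::] * G [::].

Lemma tenDl F1 F2 G s : ten (F1 \+ F2) G s = ten F1 G s + ten F2 G s.
Proof.
elim: s F1 F2 => [|a s IH] F1 F2 /=; rewrite mulrDl //.
by rewrite contrD IH addrACA.
Qed.

Lemma tenNl F G s : ten (\- F) G s = - ten F G s.
Proof.
elim: s F => [|a s IH] F /=; rewrite mulNr //.
by rewrite contrN IH opprD.
Qed.

Lemma ten0 G s : ten (fun=> 0) G s = 0.
Proof.
by elim: s => [|a s IH] /=; rewrite mul0r // add0r -[contr a _]/(fun=> 0) IH.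
Qed.

Lemma insMl b x F : ins b (fun s => x * F s) = fun s => x * ins b F s.
Proof.
apply/funext => s; elim: s F => [|a s IH] F //=.
by rewrite contrZ IH mulrBr.
Qed.

(** The inserted b lands in the left factor or in the right one; in the second case it has passed
    the whole left factor, whence [par F]. *)
Lemma ins_ten b F G s :
  ins b (ten F G) s = ten (ins b F) G s + ten (par F) (ins b G) s.
Proof.
elim: s F => [|a s IH] F /=.
  by rewrite /contr /par /= mul1r addrC.
have -> : contr a (ten F G) =
    (fun t => F [::] * contr a G t) \+ ten (contr a F) G by [].
have -> : contr a (ins b F) = contr a (contr b F) \+ \- ins b (contr a F) by [].
rewrite insD insMl /= IH tenDl tenNl contr_par tenNl /par /= mul1r.
rewrite mulrBr /contr !opprD.
by rewrite (AC ((1*(1*1))*(1*(1*1))) ((2*(3*5))*((1*4)*6))).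
Qed.

Lemma ins_par b F : ins b (par F) = \- par (ins b F).
Proof.
apply/funext => s; elim: s F => [|a s IH] F /=.
  by rewrite /par /= expr1 mulN1r mul1r.
rewrite contr_par insN /= IH opprK /par /= !exprS !mulN1r.
by rewrite !(mulNr, opprK) [in RHS]mulrBr.
Qed.

Lemma asym_par F : asym (par F) = par (asym F).
Proof.
apply/funext => s; rewrite /par; elim: s F => [|a s IH] F //=.
by rewrite -/(par F) ins_par asymN -/(par _) IH exprS mulN1r mulNr.
Qed.

(** Under [asym], the rule [ins_ten] becomes the antiderivation rule that defines [shuf], so the two
    recursions coincide. *)
Lemma asym_ten F G s : asym (ten F G) s = shuf (asym F) (asym G) s.
Proof.
elim: s F G => [|a s IH] F G //=.
have -> : ins a (ten F G) = ten (ins a F) G \+ ten (par F) (ins a G).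
  by apply/funext => t; exact: ins_ten.
by rewrite asymD !IH asym_par.
Qed.

Definition args n (a : 'I_n -> g) := [seq a i | i <- enum 'I_n].

Lemma size_args n (a : 'I_n -> g) : size (args a) = n.
Proof. by rewrite size_map size_enum_ord. Qed.

Lemma argsS n (a : 'I_n.+1 -> g) : args a = a ord0 :: args (a \o lift ord0).
Proof. by rewrite /args enum_ordSl /= -map_comp. Qed.

Lemma nth_args x0 n (a : 'I_n -> g) (i : 'I_n) : nth x0 (args a) i = a i.
Proof. by rewrite (nth_map i) ?size_enum_ord // nth_ord_enum. Qed.

Lemma args_insert n (a : 'I_n.+1 -> g) (k : 'I_n.+1) :
  args a = insert k (a k) (args (a \o lift k)).
Proof.
have sk : (k <= size (args (a \o lift k)))%N by rewrite size_args -ltnS.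
have E : size (args a) = size (insert k (a k) (args (a \o lift k))).
  by rewrite size_cat /= size_drop size_takel // !size_args addnS subnKC //
    -ltnS.
apply: (eq_from_nth (x0 := a k) E) => m; rewrite size_args => mn.
rewrite -[m]/(val (Ordinal mn)) nth_args nth_cat size_takel //.
case: (unliftP k (Ordinal mn)) => [j|] -> /=; last by rewrite ltnn subnn.
rewrite /bump; case: (leqP k j) => kj.
  rewrite add1n ltnNge (leqW kj) /= subSn //= nth_drop subnKC //.
  by rewrite nth_args.
by rewrite add0n kj nth_take // nth_args.
Qed.

Lemma asym_perm n F (a : 'I_n -> g) :
  \sum_(tau : 'S_n) (-1) ^+ tau * F (args (a \o tau)) = asym F (args a).
Proof.
elim: n F a => [|n IH] F a.
  rewrite (eq_bigr (fun=> F [::])) => [|tau _]; last first.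
    have -> : tau = 1%g by apply/permP => -[].
    rewrite odd_perm1 mul1r; congr F.
    by apply: size0nil; rewrite size_args.
  rewrite sumr_const card_Sn fact0 mulr1n.
  have -> //: args a = [::] by apply: size0nil; rewrite size_args.
(* A permutation of n + 1 indices amounts to the place k where it takes the value 0 and a
   permutation of the others. In the permuted list [a ord0] stands at place k, and the sign is
   (-1)^k times that of the rest. *)
pose f (x : 'I_n.+1 * 'S_n) := lift_perm x.1 ord0 x.2.
have f_inj : injective f.
  move=> [k s] [k' s'] E; rewrite /f /= in E.
  have kk' : k = k'.
    apply: (@perm_inj _ (lift_perm k ord0 s)).
    by rewrite {2}E !lift_perm_id.
  rewrite -{}kk' in E *; congr (_, _); apply/permP => j.
  by apply: (@lift_inj _ ord0); rewrite -!(lift_perm_lift k) E.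
have f_bij : bijective f.
  apply: (inj_card_bij f_inj).
  by rewrite card_prod card_ord !card_Sn factS.
rewrite (reindex f) /=; last exact: onW_bij.
rewrite -(pair_bigA _ (fun k sigma =>
  (-1) ^+ lift_perm k ord0 sigma * F (args (a \o lift_perm k ord0 sigma)))) /=.
rewrite argsS /= -IH exchange_big /=; apply: eq_bigr => s _.
rewrite ins_sum size_args mulr_sumr; apply: eq_bigr => k _.
rewrite odd_lift_perm addbF signr_addb signr_odd -!mulrA.
rewrite !mulrA; congr (_ * F _); first by rewrite commr_sign.
rewrite (args_insert _ k) /= lift_perm_id; congr (insert _ _ (args _)).
by apply/funext => j /=; rewrite lift_perm_lift.
Qed.

End Ring.
End Antisymmetrization.

Section TensorPower.
Variables (g : Type) (V : pzRingType).

Fixpoint tpow (r : seq g -> V) p : seq g -> V :=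
  if p is p'.+1 then ten r (tpow r p') else unit_cochain V.

Lemma ins0 (a : g) s : ins a (fun=> 0 : V) s = 0.
Proof.
by elim: s => [|b s IH] //=; rewrite -[contr b _]/(fun=> 0) IH subrr.
Qed.

Lemma asym0 (s : seq g) : asym (fun=> 0 : V) s = 0.
Proof.
elim: s => [|a s IH] //=; rewrite -[RHS]IH; congr (asym _ _).
by apply/funext => t; rewrite ins0.
Qed.

Lemma asym_tpow r p s : asym (tpow r p) s = shpow (asym r) p s.
Proof.
elim: p s => [|p IH] s /=; last first.
  by rewrite asym_ten; congr (shuf _ _ _); apply/funext.
case: s => [|a s] //=.
rewrite -[RHS](asym0 s); congr (asym _ _); apply/funext => -[|b t] //=.
by rewrite -[contr b _]/(fun=> 0) ins0 subrr.
Qed.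

Lemma shpow_mulrn (r : seq g -> V) m p s :
  shpow (fun t => r t *+ m) p s = shpow r p s *+ m ^ p.
Proof.
elim: p s => [|p IH] s //=.
have -> : shpow (fun t => r t *+ m) p = fun t => (m ^ p)%:R * shpow r p t.
  by apply/funext => t; rewrite IH mulr_natl.
have -> : (fun t => r t *+ m) = fun t => m%:R * r t.
  by apply/funext => t; rewrite mulr_natl.
have cn n : central (n%:R : V) by move=> x; apply/commr_sym/commr_nat.
by rewrite shufZl // shufZr // mulrA -natrM -expnS mulr_natl.
Qed.

(** As r lives in degree 2, only the splitting of s into consecutive pairs survives. *)
Lemma tpow2 x0 r p s : (forall t, size t != 2 -> r t = 0) -> size s = p.*2 ->
  tpow r p s = \prod_(i < p) r [:: nth x0 s i.*2; nth x0 s i.*2.+1].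
Proof.
move=> r2; elim: p s => [|p IH] [|a [|b s]] //=; first by rewrite big_ord0.
move=> [sp]; rewrite r2 // mul0r add0r.
have -> : contr b (contr a r) = fun t => if t is [::] then r [:: a; b] else 0.
  by apply/funext => -[|c t] //; rewrite /contr r2.
rewrite {1}/contr r2 // mul0r add0r big_ord_recl /= -IH //.
have ten0' (x : V) h t : ten (fun t : seq g => if t is [::] then x else 0) h t
  = x * h t.
  by case: t => [|c t] //=; rewrite -[contr c _]/(fun=> 0) ten0 addr0.
by rewrite ten0'.
Qed.

End TensorPower.

(** * The explicit differential *)

Section Explicit.
Variables (R : pzRingType) (g : Type) (br : g -> g -> g) (V : lmodType R).
Variables (act : g -> V -> V) (x0 : g).
Implicit Types (w : seq g -> V) (s : seq g).

Definition del (i : nat) s := take i s ++ drop i.+1 s.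

(** The sign comes from moving the bracket from place j to the front. *)
Lemma lie_br_alt a w s : alternating w ->
  lie_br br a w s =
  \sum_(j < size s) (-1) ^+ j *: w (br a (nth x0 s j) :: del j s).
Proof.
elim: s w => [|b s IH] w aw /=; first by rewrite big_ord0.
rewrite big_ord_recl /= expr0 scale1r (IH _ (alt_contr b aw)); congr (_ + _).
  by rewrite /del /= drop0.
apply: eq_bigr => j _; rewrite exprS mulN1r scaleNr /contr.
by rewrite (aw [::] b) scalerN.
Qed.

Lemma dif_alt w s : alternating w ->
  dif br act w s =
  \sum_(i < size s) (-1) ^+ i *: act (nth x0 s i) (w (del i s)) +
  \sum_(i < size s) \sum_(j < size s | (i < j)%N)
    (-1) ^+ (i + j) *: w (br (nth x0 s i) (nth x0 s j) :: del i (del j s)).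
Proof.
elim: s w => [|a s IH] w aw /=; first by rewrite !big_ord0 addr0.
rewrite !big_ord_recl /= expr0 scale1r {1}/del /= drop0.
rewrite (IH _ (alt_contr a aw)) /lie (lie_br_alt a s aw).
rewrite [X in _ = _ + (X + _)]big_mkcond big_ord_recl /= add0r.
have -> : \sum_(i < size s) (-1) ^+ bump 0 i *:
      act (nth x0 s i) (w (del (bump 0 i) (a :: s))) =
    - \sum_(i < size s) (-1) ^+ i *: act (nth x0 s i) (contr a w (del i s)).
  by rewrite -sumrN; apply: eq_bigr => i _; rewrite exprS mulN1r scaleNr.
have -> : \sum_(i < size s) (-1) ^+ (0 + bump 0 i) *:
      w (br a (nth x0 s i) :: del 0 (del (bump 0 i) (a :: s))) =
    - \sum_(i < size s) (-1) ^+ i *: w (br a (nth x0 s i) :: del i s).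
  rewrite -sumrN; apply: eq_bigr => i _; rewrite exprS mulN1r scaleNr.
  by rewrite {1}/del /= drop0.
have -> : \sum_(i < size s) \sum_(j < (size s).+1 | (bump 0 i < j)%N)
      (-1) ^+ (bump 0 i + j) *: w (br (nth x0 s i) (nth x0 (a :: s) j) ::
        del (bump 0 i) (del j (a :: s))) =
    - \sum_(i < size s) \sum_(j < size s | (i < j)%N) (-1) ^+ (i + j) *:
      contr a w (br (nth x0 s i) (nth x0 s j) :: del i (del j s)).
  rewrite -sumrN; apply: eq_bigr => i _.
  rewrite big_mkcond big_ord_recl /= add0r -big_mkcond -sumrN.
  apply: eq_big => [j|j _]; first by rewrite /bump !add1n ltnS.
  rewrite /bump !add1n addnS addSn !exprS !mulN1r opprK /contr.
  by rewrite -scalerN -(aw [::]).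
by rewrite opprD (AC ((1*1)*2) ((1*3)*(2*4))).
Qed.

End Explicit.

Lemma args_del (g : Type) n (a : 'I_n.+1 -> g) (i : 'I_n.+1) :
  args (a \o lift i) = del i (args a).
Proof.
rewrite (args_insert a i) /del /insert.
have si : size (take i (args (a \o lift i))) = i.
  by rewrite size_takel // size_args -ltnS.
rewrite take_size_cat // drop_cat si ltnNge leqnSn /= subSnn /= drop0.
by rewrite cat_take_drop.
Qed.

Section DA.
Variables (R : realType) (M : manifold R) (A : lie_algebroid M).
Local Notation act := (fun a : 'Gamma(A) => vf_act (anchor_vf a)).

Lemma args_bracket n (a : 'I_n.+1 -> 'Gamma(A)) (i j : 'I_n.+1) :
  (i < j)%N -> args (bracket_args a i j) =
    bracket (a i) (a j) :: del i (del j (args a)).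
Proof.
case: n a i j => [|n] a i j ij.
  by move: ij; rewrite [i]ord1 [j]ord1.
(* As i < j, the index i keeps its number once entry j is deleted, and it is in range for the
   shorter list. *)
have in1 : (i < n.+1)%N by apply: leq_trans ij _; rewrite -ltnS.
rewrite -args_del.
have -> : (i : nat) = Ordinal in1 by [].
rewrite -args_del argsS; congr (_ :: args _); apply/funext => k /=.
rewrite /bracket_args /=; congr (a _); apply/val_inj => /=.
(* Two bumps raise an index below n by at most 2, so [inord] is applied in range and its default
   value never occurs. *)
rewrite inordK // /bump add0n; have kn : (k < n)%N := ltn_ord k.
have := leq_b1 (i <= k)%N; move: (nat_of_bool (i <= k)%N) => b1 b1P.
have := leq_b1 (j <= b1 + k)%N; move: (nat_of_bool (j <= b1 + k)%N) => b2 b2P.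
rewrite -[n.+2]/(2 + n)%N.
apply: leq_ltn_trans (leq_add b2P (leq_add b1P (leqnn k))) _.
by rewrite !add1n !ltnS.
Qed.

Lemma dA_dif n (w : seq 'Gamma(A) -> smooth_fun M) (a : 'I_n.+1 -> 'Gamma(A)) :
  alternating w ->
  dA (fun b : 'I_n -> 'Gamma(A) => w (args b)) a =
  dif (@bracket _ _ A) act w (args a).
Proof.
move=> aw; rewrite (dif_alt _ _ (a ord0) _ aw) size_args /dA.
congr (_ + _); apply: eq_bigr => i _; first by rewrite nth_args args_del.
by apply: eq_bigr => j ij; rewrite !nth_args args_bracket.
Qed.

End DA.

(** * Bump functions *)

Section CkMore.
Local Open Scope classical_set_scope.
Variables (R : realType) (V : normedModType R).

Lemma CkV k (U : set V) (f : V -> R) : open U -> (forall x, U x -> f x != 0) ->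
  Ck k U f -> Ck k U (fun x => (f x)^-1).
Proof.
move=> oU f0; elim: k => [|k IH].
  by move=> cf x Ux; apply: cvgV; [apply: f0 | apply: cf].
move=> Hf; have [df Cf] := Hf; have Cv := IH (CkS Hf); split=> [x Ux|v].
  by apply: differentiableV; [apply: df | apply: f0].
have := CkM oU (CkM oU (@Ck_cst _ V R k U (-1)) (CkM oU Cv Cv)) (Cf v).
apply: Ck_ext => // x Ux; rewrite [in RHS](diffV (df x Ux) (f0 x Ux)) /=.
by rewrite -[_ *: _]/(_ * _) expr2 invfM mulN1r.
Qed.

Lemma Ck_comp k (U : set V) (W : set R) (f : V -> R) (g : R -> R) : open U ->
  (forall x, U x -> W (f x)) -> Ck k U f -> Ck k W g -> Ck k U (g \o f).
Proof.
move=> oU fW; elim: k g => [|k IH] g.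
  by move=> cf cg x Ux; apply: continuous_comp; [apply: cf | apply/cg/fW].
move=> Hf [dg Cg]; have [df Cf] := Hf; split=> [x Ux|v].
  by apply: differentiable_comp; [apply: df | apply/dg/fW].
have := CkM oU (Cf v) (IH _ (CkS Hf) (Cg 1)).
apply: Ck_ext => // x Ux.
rewrite [in RHS](diff_comp (df x Ux) (dg _ (fW x Ux))) /=.
by rewrite -[X in _ = 'd g _ X]mulr1 linearZ.
Qed.

Lemma Ck_coord n k (U : set V) (f : V -> 'rV[R]_n) i : open U ->
  Ck k U f -> Ck k U (fun x => f x 0 i).
Proof.
move=> oU; elim: k f => [|k IH] f.
  move=> cf x Ux; apply: (@continuous_comp _ _ _ f (fun y : 'rV[R]_n => y 0 i)).
    exact: cf.
  exact: coord_continuous.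
case=> df Cf; pose c (y : 'rV[R]_n) : R := y 0 i.
have dc y : differentiable c y by exact: differentiable_coord.
split=> [x Ux|v]; first exact: differentiable_comp (df x Ux) (dc _).
apply: Ck_ext (IH _ (Cf v)) => // x Ux.
rewrite [in RHS](diff_comp (df x Ux) (dc _)) /=.
have lc : linear c by move=> a y z; rewrite /c !mxE.
pose cl : {linear 'rV[R]_n -> R} := HB.pack c (GRing.isLinear.Build _ _ _ _ _
  lc).
by rewrite -[c]/(cl : _ -> _) (@diff_lin _ _ _ cl) // => y;
  exact: coord_continuous.
Qed.

Lemma Ck_sum k (U : set V) (I : Type) (r : seq I) (F : I -> V -> R) : open U ->
  (forall i, Ck k U (F i)) -> Ck k U (fun x => \sum_(i <- r) F i x).
Proof.
move=> oU CF; elim: r => [|i r IH].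
  by apply: Ck_ext (@Ck_cst _ V R k U 0) => // x _; rewrite big_nil.
by apply: Ck_ext (CkD oU (CF i) IH) => // x _; rewrite big_cons.
Qed.

End CkMore.

Section FlatFunction.
Local Open Scope classical_set_scope.
Variable R : realType.

(* For n = 0 this is the usual flat function.  The parameter n makes the family
   stable under differentiation, up to linear combinations. *)
Definition flat n (t : R) : R :=
  if 0 < t then t^-1 ^+ n * expR (- t^-1) else 0.

Lemma flat_gt0 n t : (0 < flat n t) = (0 < t).
Proof.
rewrite /flat; case: ifP => [t0|]; last by rewrite ltxx.
by rewrite mulr_gt0 ?expR_gt0 // exprn_gt0 // invr_gt0.
Qed.

(** For t > 0 and u = 1/t this is u^(n+1) / (n+1)! <= exp u. The difference quotient of [flat n] at
    0 is [flat n.+1], so the bound for n + 1 shows that the derivative at 0 vanishes. *)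
Lemma flat_le n t : `|flat n t| <= n.+1`!%:R * `|t|.
Proof.
rewrite /flat; case: ifP => t0; last first.
  by rewrite normr0 mulr_ge0.
have u0 : 0 < t^-1 by rewrite invr_gt0.
have := @expR_ge1Dxn R t^-1 n (ltW u0).
rewrite !ger0_norm ?(ltW t0) ?mulr_ge0 ?exprn_ge0 ?expR_ge0 ?(ltW u0) //.
move=> h; have {h} h : t^-1 ^+ n.+1 / n.+1`!%:R <= expR t^-1.
  by apply: le_trans h; rewrite lerDr.
rewrite expRN ler_pdivrMr ?expR_gt0 //.
have f0 : 0 < n.+1`!%:R :> R by rewrite ltr0n fact_gt0.
rewrite ler_pdivrMr // in h.
have -> : t^-1 ^+ n = t * t^-1 ^+ n.+1 by rewrite exprS mulrA divff ?mul1r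
  ?gt_eqF.
by rewrite (mulrC n.+1`!%:R) -mulrA ler_pM2l // mulrC.
Qed.

Lemma is_derive_flat n (t : R) :
  is_derive t 1 (flat n) (flat n.+2 t - n%:R * flat n.+1 t).
Proof.
have [t0|t0|->] := ltgtP t 0.
- have -> : flat n.+2 t - n%:R * flat n.+1 t = 0.
    by rewrite /flat ltNge (ltW t0) /= mulr0 subr0.
  apply: (@near_eq_is_derive _ _ _ (cst 0)).
  near=> s; rewrite /flat ltNge ltW //=.
  near: s; exact: lt_nbhsl.
- have tn0 : t != 0 by rewrite gt_eqF.
  pose F : R -> R := (fun s : R => s^-1) ^+ n * (expR \o (fun s : R => - s^-1)).
  suff : is_derive t 1 F (flat n.+2 t - n%:R * flat n.+1 t).
    apply: near_eq_is_derive; near=> s; rewrite /flat ifT.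
      by rewrite /F -[RHS]/(_ * _) exprfctE.
    by near: s; exact: lt_nbhsr.
  have dV : is_derive t 1 (fun s : R => s^-1) (- t ^- 2).
    have := @is_deriveV R id t 1 1 tn0 (is_derive_id _ _).
    by rewrite /= -[_ *: 1]/(_ * 1) mulr1.
  have dE : is_derive t 1 (expR \o (fun s : R => - s^-1))
      (expR (- t^-1) * t ^- 2).
    apply: is_derive1_comp; have := is_deriveN dV.
    by rewrite opprK.
  have dX := is_deriveX n dV.
  have dM := is_deriveM dX dE; apply: (is_derive_eq dM).
  rewrite /= /flat t0 -![_ *: _]/(_ * _).
  rewrite exprfctE -!exprVn; case: (n) => [|m] /=; first by ring.
  by rewrite !exprS; ring.
- have -> : flat n.+2 0 - n%:R * flat n.+1 0 = 0 :> R.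
    by rewrite /flat ltxx /= mulr0 subr0.
  have cv : (fun h => h^-1 *: ((flat n \o shift 0) (h *: 1) - flat n 0))
      @ 0^' --> (0 : R).
    apply/cvgrPdist_le => e e0; near=> h.
    rewrite sub0r normrN /= addr0 [flat n 0]/flat ltxx subr0.
    rewrite -[h *: 1]/(h * 1) mulr1 -[_ *: _]/(h^-1 * _).
    have -> : h^-1 * flat n h = flat n.+1 h.
      by rewrite /flat; case: ifP; rewrite ?mulr0 // exprS mulrA.
    apply: le_trans (flat_le _ _) _.
    rewrite mulrC -ler_pdivlMr ?ltr0n ?fact_gt0 //.
    near: h; apply: dnbhs0_le; rewrite divr_gt0 // ltr0n fact_gt0 //.
  by split; [exact: cvgP cv | exact: cvg_lim cv].
Unshelve. all: by end_near. Qed.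

Lemma Ck_flat k n : Ck k [set: R] (flat n).
Proof.
have df m x : differentiable (flat m) x.
  by apply/derivable1_diffP; case: (is_derive_flat m x).
elim: k n => [|k IH] n; first by move=> x _; exact: differentiable_continuous.
split=> [x _|v]; first exact: df.
have := CkM openT (@Ck_cst _ R R k setT v)
  (CkD openT (IH n.+2) (CkM openT (@Ck_cst _ R R k setT (- n%:R)) (IH n.+1))).
apply: Ck_ext openT _ => x _; rewrite diff1E // derive1E.
by have [_ ->] := is_derive_flat n x; rewrite mulNr.
Qed.

End FlatFunction.

Section SmoothMore.
Local Open Scope classical_set_scope.
Variables (R : realType) (M : manifold R).

Lemma smooth_onV (U : set M) (f : M -> R) : open U ->
  (forall x, U x -> f x != 0) ->
  smooth_on U f -> smooth_on U (fun x => (f x)^-1).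
Proof.
move=> oU f0 sf c ac k; apply: (CkV (chart_img_open oU) _ (sf c ac k)).
by move=> y [_ Uy]; apply: f0.
Qed.

(** Extension by zero: D is covered by its part in U and by the open complement of K, where f
    vanishes. *)
Lemma smooth_on_glue (D U K : set M) (f : M -> R) : closed K -> K `<=` U ->
  (forall x, ~ K x -> f x = 0) -> smooth_on (U `&` D) f -> smooth_on D f.
Proof.
move=> clK KU f0 sf; apply: smooth_on_loc => x Dx.
have [Kx|nKx] := pselect (K x); first by exists (U `&` D) => //; split => //;
  exact: KU.
exists (~` K) => //; apply: smooth_on_ext (smooth_on_cst _ 0).
  exact: closed_openC.
by move=> y /f0 ->.
Qed.

Lemma smooth_fun_continuous (f : smooth_fun M) : continuous f.
Proof.
move=> x; have [c ac cx] := mfd_cover x.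
have cf : {for x, continuous ((f \o cinv c) \o cmap c)}.
  apply: continuous_comp; first exact: cmap_continuous.
  by apply: (sfunP f ac 0); split => //; exact: cmap_range.
rewrite /continuous_at -[in X in _ --> X](cmapK cx).
apply: cvg_trans cf; apply: near_eq_cvg.
have : \near x, cdom c x by apply: open_nbhs_nbhs; split=> //; exact: cdom_open.
by apply: filterS => y cy /=; rewrite cmapK.
Qed.

End SmoothMore.

Section Bump.
Local Open Scope classical_set_scope.
Variables (R : realType) (M : manifold R).

(** The norm of ['rV[R]_n] is the maximum norm, which is not smooth in general; hence the squared
    Euclidean distance. *)
Definition sqdist n (u y : 'rV[R]_n) := \sum_(i < n) (y 0 i - u 0 i) ^+ 2.

Lemma sqdist_coord n (u y : 'rV[R]_n) i e : 0 <= e ->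
  sqdist u y <= e ^+ 2 -> `|y 0 i - u 0 i| <= e.
Proof.
move=> e0 h; rewrite -(@ler_pXn2r _ 2) ?nnegrE // real_normK ?num_real //.
apply: le_trans h; rewrite /sqdist (bigD1 i) //= lerDl.
by apply: sumr_ge0 => j _; rewrite sqr_ge0.
Qed.

Lemma Ck_sqdist n (V : normedModType R) k (U : set V) (f : V -> 'rV[R]_n) u :
  open U -> Ck k U f -> Ck k U (fun x => sqdist u (f x)).
Proof.
move=> oU Cf; apply: Ck_sum => // i.
have Ci := CkD oU (Ck_coord i oU Cf) (@Ck_cst _ V R k U (- u 0 i)).
exact: (CkM oU Ci Ci).
Qed.

Lemma sqdist_continuous n (u : 'rV[R]_n) : continuous (sqdist u).
Proof.
have : Ck 0 [set: 'rV[R]_n] (sqdist u).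
  apply: Ck_sqdist; first exact: openT.
  by move=> x _; exact: cvg_id.
by move=> h x; apply: h.
Qed.

Lemma sqdist_compact n (u : 'rV[R]_n) e : 0 <= e ->
  compact [set y | sqdist u y <= e ^+ 2].
Proof.
move=> e0; apply: bounded_closed_compact.
  exists (e + `|u|); split; first exact: num_real.
  move=> m em y /= ye; apply: le_trans (ltW em).
  rewrite -[y](subrK u); apply: le_trans (ler_normD _ _) _; rewrite lerD2r.
  rewrite [leLHS]/Num.norm /= mx_normrE; apply/bigmax_leP;
    split=> // -[i j] _ /=.
  by rewrite !mxE ord1; apply: sqdist_coord.
rewrite (_ : mkset _ = sqdist u @^-1` [set t | t <= e ^+ 2]) //.
apply: preimage_closed => [y _|]; first exact: sqdist_continuous.
exact: closed_le.
Qed.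

(** K is a closed coordinate ball around x. It is compact, hence closed in M because M is Hausdorff,
    and this makes the extension by zero smooth. Halving the radius e keeps the closed ball inside
    the open one. *)
Lemma bump (U : set M) (x : M) : open U -> U x ->
  exists (b : smooth_fun M) (K : set M),
    [/\ b x = 1, closed K, K `<=` U & forall y, ~ K y -> b y = 0].
Proof.
move=> oU Ux; have [c ac cx] := mfd_cover x.
pose u := cmap c x; have oW := chart_img_open (c := c) oU.
have Wu : chart_img c U u by split; [exact: cmap_range | rewrite /u cmapK].
have /nbhs_ballP[e e0 We] : nbhs u (chart_img c U) by exact: open_nbhs_nbhs.
rewrite /= in e0; pose r := e / 2; have r0 : 0 < r by rewrite divr_gt0.
pose Bl := [set y | sqdist u y <= r ^+ 2].
have BW : Bl `<=` chart_img c U.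
  move=> y By; apply: We; split=> // i j; rewrite ord1 /ball /= distrC.
  apply: le_lt_trans (sqdist_coord j (ltW r0) By) _.
  by rewrite /r ltr_pdivrMr // ltr_pMr // ltr1n.
pose K := cinv c @` Bl.
have cK : compact K.
  have cB : compact Bl := @sqdist_compact _ u r (ltW r0).
  apply: continuous_compact; last exact: cB.
  apply: continuous_in_subspaceT => y; rewrite inE => /BW[cy _].
  exact: cinv_continuous.
have clK : closed K := compact_closed (@mfd_hausdorff _ M) cK.
have KU : K `<=` U by move=> _ [y /BW[_ Uy] <-].
pose b0 (y : M) := if `[< cdom c y >] then flat 0 (r ^+ 2 - sqdist u (cmap c
  y)) else 0.
have b0K y : ~ K y -> b0 y = 0.
  move=> nK; rewrite /b0; case: asboolP => // cy; rewrite /flat ifF //.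
  apply/negbTE/negP; rewrite subr_gt0 => h; apply: nK.
  by exists (cmap c y); [exact: ltW | exact: cmapK].
have sb0 : smooth_on setT b0.
  apply: (smooth_on_glue clK (U := cdom c)) b0K _ => [_ [y /BW[cy _] <-]|].
    exact: cinv_dom.
  rewrite setIT.
  move=> c' ac' k; have oI := chart_img_open (c := c') (cdom_open c).
  have Cq := Ck_sqdist u oI (mfd_compat ac' ac k).
  have Cr := CkD oI (@Ck_cst _ _ R k _ (r ^+ 2))
    (CkM oI (@Ck_cst _ _ R k _ (-1)) Cq).
  apply: Ck_ext (Ck_comp oI (fun _ _ => I) Cr (@Ck_flat R k 0)) => //.
  by move=> y [_ cy]; rewrite /= /b0 asboolT // mulN1r.
have bx : b0 x = flat 0 (r ^+ 2).
  rewrite /b0 asboolT // /sqdist big1 ?subr0 // => i _.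
  by rewrite subrr expr0n.
have bx0 : b0 x != 0 by rewrite bx gt_eqF // flat_gt0 exprn_gt0.
exists ((b0 x)^-1 *: SmoothFun sb0), K; split => //.
  by rewrite /= mulVf.
by move=> y /b0K /= ->; rewrite mulr0.
Qed.

End Bump.

(** * Tensorial operators and their trace *)

Section Sections.
Local Open Scope classical_set_scope.
Variables (R : realType) (M : manifold R) (E : vbundle M).
Local Notation S := 'Gamma(E).
Local Notation C := (smooth_fun M).

Lemma sf_sumE (I : Type) (r : seq I) (F : I -> C) x :
  (\sum_(i <- r) F i) x = \sum_(i <- r) F i x.
Proof. exact: (big_morph (fun f : C => f x) (fun _ _ => erefl) erefl). Qed.

Lemma sec_sumE (I : Type) (r : seq I) (F : I -> S) x :
  (\sum_(i <- r) F i) x = \sum_(i <- r) F i x.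
Proof. exact: (big_morph (fun s : S => s x) (fun _ _ => erefl) erefl). Qed.

Lemma secMA (f h : C) (s : S) : f *:: (h *:: s) = (f * h) *:: s.
Proof. by apply: section_ext => x /=; rewrite scalerA. Qed.
Lemma sec1M (s : S) : 1 *:: s = s.
Proof. by apply: section_ext => x /=; rewrite scale1r. Qed.
Lemma secMDr (f : C) (s u : S) : f *:: (s + u) = f *:: s + f *:: u.
Proof. by apply: section_ext => x /=; rewrite scalerDr. Qed.
Lemma secMDl (f h : C) (s : S) : (f + h) *:: s = f *:: s + h *:: s.
Proof. by apply: section_ext => x /=; rewrite scalerDl. Qed.
Lemma secMr0 (f : C) : f *:: (0 : S) = 0.
Proof. by apply: section_ext => x /=; rewrite scaler0. Qed.
Lemma secMNr (f : C) (s : S) : f *:: (- s) = - (f *:: s).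
Proof. by apply: section_ext => x /=; rewrite scalerN. Qed.
Lemma secMNl (f : C) (s : S) : (- f) *:: s = - (f *:: s).
Proof. by apply: section_ext => x /=; rewrite scaleNr. Qed.
Lemma secMBr (f : C) (s u : S) : f *:: (s - u) = f *:: s - f *:: u.
Proof. by rewrite secMDr secMNr. Qed.

Definition sf_cst (k : R) : C := SmoothFun (smooth_on_cst setT k).

Lemma secZE k (s : S) : k *: s = sf_cst k *:: s. Proof. by []. Qed.

Lemma sfZE k (f : C) : k *: f = sf_cst k * f.
Proof. exact: smooth_fun_ext. Qed.

Definition tensorial (T : S -> S) := forall f s u,
  T (f *:: s + u) = f *:: T s + T u.

Definition flinear (th : S -> C) := forall f s u,
  th (f *:: s + u) = f * th s + th u.

Section TensorialTheory.
Variables (T : S -> S) (tT : tensorial T).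
Lemma tensorialD s u : T (s + u) = T s + T u.
Proof. by rewrite -[s in LHS]sec1M tT sec1M. Qed.
Lemma tensorial0 : T 0 = 0.
Proof. by apply: (@addrI _ (T 0)); rewrite -tensorialD !addr0. Qed.
Lemma tensorialM f s : T (f *:: s) = f *:: T s.
Proof. by rewrite -[in LHS](addr0 (f *:: s)) tT tensorial0 addr0. Qed.
Lemma tensorial_sum n (F : 'I_n -> S) : T (\sum_i F i) = \sum_i T (F i).
Proof. exact: (big_morph T tensorialD tensorial0). Qed.
End TensorialTheory.

Section FlinearTheory.
Variables (th : S -> C) (tT : flinear th).
Lemma flinearD s u : th (s + u) = th s + th u.
Proof. by rewrite -[s in LHS]sec1M tT mul1r. Qed.
Lemma flinear0 : th 0 = 0.
Proof. by apply: (@addrI _ (th 0)); rewrite -flinearD !addr0. Qed.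
Lemma flinearM f s : th (f *:: s) = f * th s.
Proof. by rewrite -[in LHS](addr0 (f *:: s)) tT flinear0 addr0. Qed.
Lemma flinearN s : th (- s) = - th s.
Proof. by apply: (@addrI _ (th s)); rewrite -flinearD !subrr flinear0. Qed.
Lemma flinear_sum n (F : 'I_n -> S) : th (\sum_i F i) = \sum_i th (F i).
Proof. exact: (big_morph th flinearD flinear0). Qed.
End FlinearTheory.

Section Local.
Variables (t : triv E) (vt : vtrivs t) (b : C) (K : set M).
Hypotheses (clK : closed K) (KU : K `<=` tdom t).
Hypothesis b0 : forall y, ~ K y -> b y = 0.

Fact loc_sec_smooth v t' : vtrivs t' -> forall k,
  smooth_on (tdom t') (fun x => tmap t' x (b x *: tinv t x v) 0 k).
Proof.
move=> vt' k; apply: (smooth_on_glue clK KU) => [x /b0 ->|].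
  by rewrite scale0r linear0 mxE.
have oI : open (tdom t `&` tdom t') by apply: openI; exact: tdom_open.
have sb : smooth_on (tdom t `&` tdom t') b := smooth_on_sub (@subsetT _ _)
  (sfunP b).
apply: smooth_on_ext oI _ (smooth_onM oI sb (vcompat vt vt' v k)) => x _.
by rewrite linearZ mxE.
Qed.

Definition loc_sec v : S := MkSection (loc_sec_smooth v).

Fact loc_coord_smooth (i : 'I_(trank t)) (s : S) :
  smooth_on setT (fun x => b x * tmap t x (s x) 0 i).
Proof.
apply: (smooth_on_glue clK KU) => [x /b0 ->|]; first by rewrite mul0r.
rewrite setIT; apply: smooth_onM; [exact: tdom_open | | exact: sectionP].
exact: smooth_on_sub (@subsetT _ _) (sfunP b).
Qed.

Definition loc_coord i s : C := SmoothFun (loc_coord_smooth i s).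

Lemma loc_coord_flinear i : flinear (loc_coord i).
Proof.
move=> f s u; apply: smooth_fun_ext => x /=.
by rewrite linearD linearZ !mxE mulrDr mulrCA.
Qed.

Lemma tdom_or x : tdom t x \/ b x = 0.
Proof.
have [Kx|/b0] := pselect (K x); last by right.
by left; exact: KU.
Qed.

(** The square appears because the coordinates and the frame are both cut off by b. *)
Lemma loc_frame s :
  (b * b) *:: s = \sum_i loc_coord i s *:: loc_sec (delta_mx 0 i).
Proof.
apply: section_ext => x; rewrite sec_sumE /=.
have [tx|->] := tdom_or x; last first.
  by rewrite mul0r scale0r big1 // => i _; rewrite mul0r scale0r.
rewrite -{1}(tmapK tx (s x)) {1}(row_sum_delta (tmap t x (s x))) linear_sum.
rewrite scaler_sumr; apply: eq_bigr => i _.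
by rewrite linearZ !scalerA mulrAC.
Qed.

Lemma tensorial_local T s x : tensorial T -> b x = 1 ->
  T s x = \sum_i tmap t x (s x) 0 i *: T (loc_sec (delta_mx 0 i)) x.
Proof.
move=> tT bx; have := congr1 (fun u : S => u x) (congr1 T (loc_frame s)).
rewrite tensorialM // tensorial_sum // sec_sumE /= bx mulr1 scale1r => ->.
by apply: eq_bigr => i _; rewrite tensorialM //= bx mul1r.
Qed.

Lemma endo_tr_frame (phi : endo E) (T : S -> S) :
  (forall s x, T s x = phi x (s x)) ->
  (b * b) * endo_tr phi = \sum_i loc_coord i (T (loc_sec (delta_mx 0 i))).
Proof.
move=> Tphi; apply: smooth_fun_ext => x; rewrite sf_sumE /=.
have [tx|->] := tdom_or x; last first.
  by rewrite !mul0r big1 // => i _; rewrite mul0r.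
rewrite (fiber_trE _ tx) /mxtrace mulr_sumr; apply: eq_bigr => i _.
by rewrite Tphi /= !linearZ !mxE /= mulrA.
Qed.

End Local.

Lemma frame_at x : exists (t : triv E) (vt : vtrivs t) (b : C) (K : set M),
  [/\ closed K, K `<=` tdom t, forall y, ~ K y -> b y = 0, b x = 1 & tdom t x].
Proof.
have [t vt tx] := vcover E x; have [b [K [bx clK KU b0]]] := bump (tdom_open t)
  tx.
by exists t, vt, b, K.
Qed.

Lemma frame_in (t : triv E) x : vtrivs t -> tdom t x ->
  exists (b : C) (K : set M),
  [/\ closed K, K `<=` tdom t, forall y, ~ K y -> b y = 0 & b x = 1].
Proof.
by move=> vt tx; have [b [K [bx clK KU b0]]] := bump (tdom_open t) tx;
  exists b, K.
Qed.

Lemma tensorial_endo T : tensorial T ->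
  exists phi : endo E, forall s x, T s x = phi x (s x).
Proof.
move=> tT.
have ex x : exists phi : {linear E x -> E x}, forall s : S, T s x = phi (s x).
  have [t [vt [b [K [clK KU b0 bx tx]]]]] := frame_at x.
  pose f v := \sum_i tmap t x v 0 i *: T (loc_sec vt clK KU b0 (delta_mx 0 i))
    x.
  have lf : linear f.
    move=> k u v; rewrite /f scaler_sumr -big_split; apply: eq_bigr => i _ /=.
    by rewrite linearP !mxE scalerDl scalerA.
  pose fl : {linear E x -> E x} := HB.pack f (GRing.isLinear.Build _ _ _ _ _
    lf).
  exists fl => s.
  exact: tensorial_local.
pose phi x := sval (cid (ex x)).
have phiP s x : T s x = phi x (s x) by rewrite /phi; case: cid.
have sphi (t : triv E) : vtrivs t -> forall v k,
    smooth_on (tdom t) (fun x => tmap t x (phi x (tinv t x v)) 0 k).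
  move=> vt v k; apply: smooth_on_loc => x tx.
  have [b [K [clK KU b0 bx]]] := frame_in vt tx.
  (* Where b does not vanish, the local section with constant coordinates v is u / b for the global
     section u below; so the coordinates of its image are those of [T u] divided by b. *)
  pose W := tdom t `&` b @^-1` [set y | y != 0].
  have oW : open W.
    apply: openI; first exact: tdom_open.
    apply: open_comp => [y _|]; first exact: smooth_fun_continuous.
    exact: open_neq.
  exists W; first by split=> //=; rewrite bx oner_neq0.
  pose u := loc_sec vt clK KU b0 v.
  have sb : smooth_on W (fun y => (b y)^-1).
    apply: smooth_onV => //; first by move=> y [].
    exact: smooth_on_sub (@subsetT _ _) (sfunP b).
  have su : smooth_on W (fun y => tmap t y (T u y) 0 k).
    by apply: smooth_on_sub (sectionP (T u) vt k) => y [].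
  apply: smooth_on_ext oW _ (smooth_onM oW sb su) => y [ty by0].
  by rewrite phiP /= !linearZ mxE mulKf.
by exists (Endo sphi).
Qed.

Lemma Tr_endo T : tensorial T ->
  exists2 phi : endo E, (forall s x, T s x = phi x (s x)) & Tr T = endo_tr phi.
Proof.
move=> tT; rewrite /Tr; case: pselect => [ex|nex]; last first.
  by have := tensorial_endo tT.
by case: (cid ex) => phi /= phiP; exists phi.
Qed.

Lemma dual_basis x : exists n (f : C) (e : 'I_n -> S) (th : 'I_n -> S -> C),
  [/\ f x = 1, forall i, flinear (th i),
      forall s, f *:: s = \sum_i th i s *:: e i &
      forall T, tensorial T -> f * Tr T = \sum_i th i (T (e i))].
Proof.
have [t [vt [b [K [clK KU b0 bx tx]]]]] := frame_at x.
exists (trank t), (b * b), (fun i => loc_sec vt clK KU b0 (delta_mx 0 i)),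
  (loc_coord vt clK KU b0); split.
- by rewrite /= bx mulr1.
- exact: loc_coord_flinear.
- exact: loc_frame.
- by move=> T tT; have [phi phiP ->] := Tr_endo tT; exact: endo_tr_frame.
Qed.

(** Equality is tested at each point x by a function f with f(x) = 1. In the hypothesis f remains a
    global function, so that vector fields can act on it. *)
Lemma dual_basis_eq (g h : C) :
  (forall n (f : C) (e : 'I_n -> S) (th : 'I_n -> S -> C),
    (forall i, flinear (th i)) -> (forall s, f *:: s = \sum_i th i s *:: e i) ->
    (forall T, tensorial T -> f * Tr T = \sum_i th i (T (e i))) ->
    f * g = f * h) -> g = h.
Proof.
move=> H; apply: smooth_fun_ext => x;
  have [n [f [e [th [fx fl fr ft]]]]] := dual_basis x.
by have := congr1 (fun f : C => f x) (H _ _ _ _ fl fr ft); rewrite /= fx !mul1r.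
Qed.

Lemma TrD T U : tensorial T -> tensorial U ->
  Tr (fun s => T s + U s) = Tr T + Tr U.
Proof.
move=> tT tU; apply: dual_basis_eq => n f e th fl fr ft.
have tTU : tensorial (fun s => T s + U s).
  by move=> g s u; rewrite tT tU secMDr addrACA.
rewrite mulrDr !ft // -big_split; apply: eq_bigr => i _.
by rewrite flinearD.
Qed.

Lemma TrM g T : tensorial T -> Tr (fun s => g *:: T s) = g * Tr T.
Proof.
move=> tT; apply: dual_basis_eq => n f e th fl fr ft.
have tgT : tensorial (fun s => g *:: T s).
  by move=> g' s u; rewrite tT secMDr !secMA mulrC.
rewrite ft // mulrCA ft // mulr_sumr; apply: eq_bigr => i _.
by rewrite flinearM.
Qed.

Lemma tensorial_rank1_sum n (e : 'I_n -> S) (th : 'I_n -> S -> C) :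
  (forall i, flinear (th i)) -> tensorial (fun s => \sum_i th i s *:: e i).
Proof.
move=> lth g s u; rewrite (big_morph (secM g) (secMDr g) (secMr0 g)) -big_split.
by apply: eq_bigr => i _; rewrite lth secMDl secMA.
Qed.

(** After multiplication by f both sides are the double sum of th_j(e'_i) th'_i(e_j); on the right
    because f e_j is the sum of the th'_i(e_j) e'_i. *)
Lemma Tr_rank1_sum n (e : 'I_n -> S) (th : 'I_n -> S -> C) :
  (forall i, flinear (th i)) ->
  Tr (fun s => \sum_i th i s *:: e i) = \sum_i th i (e i).
Proof.
move=> lth; apply: dual_basis_eq => m f e' th' fl fr ft.
rewrite ft; last exact: tensorial_rank1_sum.
rewrite mulr_sumr.
transitivity (\sum_(i < m) \sum_(j < n) th j (e' i) * th' i (e j)).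
  apply: eq_bigr => i _; rewrite flinear_sum //.
  by apply: eq_bigr => j _; rewrite flinearM.
rewrite exchange_big /=; apply: eq_bigr => j _.
rewrite -flinearM // fr flinear_sum //; apply: eq_bigr => i _.
by rewrite flinearM // mulrC.
Qed.

Section Commutator.
Variables (D : S -> S) (X : vector_field M).
Hypothesis DD : {morph D : s u / s + u}.
Hypothesis DX : cdo_leibniz D X.

Lemma vf_actB : {morph vf_act X : f g / f - g}.
Proof.
move=> f g; apply: smooth_fun_ext => x /=.
by rewrite (_ : f - g = -1 *: g + f) ?tvec_linear ?mulN1r 1?addrC // scaleN1r
  addrC.
Qed.

Lemma vf_actD : {morph vf_act X : f g / f + g}.
Proof.
move=> f g; apply: smooth_fun_ext => x /=.
by rewrite -[f in LHS]scale1r tvec_linear mul1r.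
Qed.

Lemma vf_act0 : vf_act X 0 = 0.
Proof. by apply: (@addrI _ (vf_act X 0)); rewrite -vf_actD !addr0. Qed.

Lemma vf_actM f g : vf_act X (f * g) = vf_act X f * g + f * vf_act X g.
Proof.
by apply: smooth_fun_ext => x /=; rewrite tvec_leibniz addrC (mulrC (g x)).
Qed.

Lemma tensorial_commutator T : tensorial T ->
  tensorial (fun s => D (T s) - T (D s)).
Proof.
move=> tT f s u; rewrite tT !DD !DX !(tensorialD tT) !(tensorialM tT).
rewrite secMBr !opprD.
by rewrite [LHS](AC (3*3) ((1*4)*(3*6)*(2*5))) /= subrr addr0.
Qed.

(* Apply D to f s = sum_i th_i(s) e_i, compose with T and take traces:
   X(f) Tr T = sum_i (D th_i)(T e_i) + th_i(T (D e_i)). *)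
Lemma Tr_commutator T : tensorial T ->
  Tr (fun s => D (T s) - T (D s)) = vf_act X (Tr T).
Proof.
move=> tT; apply: dual_basis_eq => n f e th fl fr ft.
rewrite ft; last exact: tensorial_commutator.
have D0 : D 0 = 0 by apply: (@addrI _ (D 0)); rewrite -DD !addr0.
pose dth i s := vf_act X (th i s) - th i (D s).
have ldth i : flinear (dth i).
  move=> g s u; rewrite /dth fl DD DX !vf_actD vf_actM !(flinearD (fl i))
    !(flinearM (fl i)).
  rewrite mulrBr !opprD.
  by rewrite [LHS](AC (3*3) ((2*4)*(3*6)*(1*5))) /= subrr addr0.
have TX : (fun s => vf_act X f *:: T s) =
    (fun s => (\sum_i dth i s *:: T (e i)) + \sum_i th i s *:: T (D (e i))).
  apply/funext => s; rewrite -big_split /= -(tensorialM tT).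
  transitivity (T (\sum_i (dth i s *:: e i + th i s *:: D (e i)))); last first.
    by rewrite (tensorial_sum tT); apply: eq_bigr => i _;
      rewrite (tensorialD tT) !(tensorialM tT).
  congr (T _); apply: (@addrI _ (f *:: D s)); rewrite -DX !fr.
  rewrite (big_morph D DD D0) -big_split; apply: eq_bigr => i _ /=.
  by rewrite DX /dth secMDl secMNl [RHS]addrC [RHS]addrAC subrK [RHS]addrC.
have := congr1 (@Tr _ _ E) TX.
rewrite TrM // TrD; [|exact: tensorial_rank1_sum..].
rewrite !Tr_rank1_sum // => XfT.
(* X is applied to f Tr T = sum_i th_i(T e_i) and the formula for X(f) Tr T is subtracted; the terms
   X(th_i(T e_i)) cancel. *)
have := congr1 (vf_act X) (ft T tT).
rewrite vf_actM XfT (big_morph _ vf_actD vf_act0) => /(canRL (addKr _)) ->.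
rewrite addrC opprD addrA -!sumrB; apply: eq_bigr => i _.
rewrite (flinearD (fl i)) (flinearN (fl i)) /dth opprB.
by rewrite [X in _ = X - _]addrC subrK.
Qed.

End Commutator.

(** The common term X(f) s cancels. This serves both the curvature and the difference of two
    connections. *)
Lemma tensorial_sub (D1 D2 : S -> S) (X : vector_field M) :
  {morph D1 : s u / s + u} -> {morph D2 : s u / s + u} ->
  cdo_leibniz D1 X -> cdo_leibniz D2 X -> tensorial (fun s => D1 s - D2 s).
Proof.
move=> D1D D2D D1X D2X f s u; rewrite D1D D2D D1X D2X secMBr !opprD.
by rewrite [LHS](AC (3*3) ((1*4)*(3*6)*(2*5))) /= subrr addr0.
Qed.

Lemma fiber_section x (w : E x) : exists s : S, s x = w.
Proof.
have [t [vt [b [K [clK KU b0 bx tx]]]]] := frame_at x.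
by exists (loc_sec vt clK KU b0 (tmap t x w)); rewrite /= bx scale1r tmapK.
Qed.

End Sections.

(** * The anchor as a homomorphism of Lie algebras *)

Section AnchorHom.
Variables (R : realType) (M : manifold R) (A : lie_algebroid M).
Local Notation S := 'Gamma(A).
Local Notation C := (smooth_fun M).
Local Notation br := (@bracket _ _ A).
Local Notation rho := (fun a : S => vf_act (anchor_vf a)).

Lemma bracketDl a b c : br (a + b) c = br a c + br b c.
Proof. by rewrite -[a in LHS]scale1r bracket_linearl scale1r. Qed.

Lemma bracketDr a b c : br a (b + c) = br a b + br a c.
Proof. by rewrite -[b in LHS]scale1r bracket_linearr scale1r. Qed.

Lemma bracketC a b : br a b = - br b a.
Proof.
have := bracket_alt (a + b); rewrite bracketDl !bracketDr !bracket_alt.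
by rewrite addr0 add0r => /eqP; rewrite addr_eq0 => /eqP.
Qed.

Lemma bracketNr a b : br a (- b) = - br a b.
Proof.
have br0 : br a 0 = 0 by apply: (@addrI _ (br a 0)); rewrite -bracketDr !addr0.
by apply: (@addrI _ (br a b)); rewrite -bracketDr !subrr.
Qed.

Lemma bracket_leibniz_jacobi a b c : br a (br b c) =
  br (br a b) c + br b (br a c).
Proof.
have := bracket_jacobi a b c; rewrite (bracketC c a) (bracketC c (br a b))
  bracketNr.
by move/eqP; rewrite subr_eq0 subr_eq => /eqP.
Qed.

(* The Jacobi identity for a, b and f c shows that the difference of both sides
   kills every section c; it vanishes where A_x = 0 because the anchor does. *)
Lemma anchor_bracket a b (f : C) :
  rho (br a b) f = rho a (rho b f) - rho b (rho a f).
Proof.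
have kill (c : S) : (rho a (rho b f) - rho b (rho a f)) *:: c = rho (br a b) f
  *:: c.
  have := bracket_leibniz_jacobi a b (f *:: c).
  rewrite !bracket_leibniz !bracketDr !bracket_leibniz bracket_leibniz_jacobi.
  rewrite secMDr secMDl secMNl => h; apply/eqP; rewrite subr_eq; apply/eqP.
  by move: h; rewrite addrA [RHS](AC (2*(2*2)) ((1*3*5*4)*(2*6))) => /addrI.
apply: smooth_fun_ext => x.
have [[w w0]|nw] := pselect (exists w : A x, w != 0).
  have [c cx] := fiber_section w.
  have /eqP := congr1 (fun s : S => s x) (kill c).
  by rewrite -subr_eq0 /= cx -scalerBl scaler_eq0 (negPf w0) orbF subr_eq0 =>
    /eqP.
have z (c : S) : c x = 0.
  by apply/eqP; apply: contrapT => /negP c0; apply: nw; exists (c x).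
by rewrite /= !z linear0 /= subrr.
Qed.

End AnchorHom.

(** * Chern forms of connections *)

Section Operators.
Variables (R : comPzRingType) (S : lmodType R).

Definition rlinear (T : S -> S) := forall k s u, T (k *: s + u) =
  k *: T s + T u.

(** Real linearity, beyond additivity, makes the scalars central in the ring of operators. That ring
    is trivial when Gamma(E) is 0. *)
Record op := Op { op_fun :> S -> S; opP : rlinear op_fun }.

Lemma op_ext (T U : op) : (forall s, T s = U s) -> T = U.
Proof.
case: T U => [T TD] [U UD] /= /funext TU; case: _ / TU in UD *.
by congr Op; exact: Prop_irrelevance.
Qed.

HB.instance Definition _ := gen_eqMixin op.
HB.instance Definition _ := gen_choiceMixin op.

Fact op0_subproof : rlinear (fun=> 0 : S).
Proof. by move=> k s u; rewrite scaler0 addr0. Qed.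
Fact opN_subproof (T : op) : rlinear (fun s => - T s).
Proof. by move=> k s u; rewrite opP opprD scalerN. Qed.
Fact opD_subproof (T U : op) : rlinear (fun s => T s + U s).
Proof. by move=> k s u; rewrite !opP addrACA scalerDr. Qed.
Fact opM_subproof (T U : op) : rlinear (fun s => T (U s)).
Proof. by move=> k s u; rewrite !opP. Qed.
Fact op1_subproof : rlinear (fun s : S => s).
Proof. by []. Qed.

Definition op_zero := Op op0_subproof.
Definition op_opp T := Op (opN_subproof T).
Definition op_add T U := Op (opD_subproof T U).
Definition op_mul T U := Op (opM_subproof T U).
Definition op_one := Op op1_subproof.

Lemma opD (T : op) : {morph T : s u / s + u}.
Proof. by move=> s u; rewrite -[s in LHS]scale1r opP scale1r. Qed.

Lemma op_at0 (T : op) : T 0 = 0.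
Proof. by apply: (@addrI _ (T 0)); rewrite -opD !addr0. Qed.

Fact op_addA : associative op_add.
Proof. by move=> T U W; apply: op_ext => s /=; rewrite addrA. Qed.
Fact op_addC : commutative op_add.
Proof. by move=> T U; apply: op_ext => s /=; rewrite addrC. Qed.
Fact op_add0 : left_id op_zero op_add.
Proof. by move=> T; apply: op_ext => s /=; rewrite add0r. Qed.
Fact op_addN : left_inverse op_zero op_opp op_add.
Proof. by move=> T; apply: op_ext => s /=; rewrite addNr. Qed.
HB.instance Definition _ := GRing.isZmodule.Build op op_addA op_addC op_add0
  op_addN.

Fact op_mulA : associative op_mul. Proof. by move=> T U W; exact: op_ext. Qed.
Fact op_mul1 : left_id op_one op_mul. Proof. by move=> T; exact: op_ext. Qed.
Fact op_mulr1 : right_id op_one op_mul. Proof. by move=> T; exact: op_ext. Qed.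
Fact op_mulDl : left_distributive op_mul op_add.
Proof. by move=> T U W; exact: op_ext. Qed.
Fact op_mulDr : right_distributive op_mul op_add.
Proof. by move=> T U W; apply: op_ext => s /=; rewrite opD. Qed.
HB.instance Definition _ :=
  GRing.Zmodule_isPzRing.Build op op_mulA op_mul1 op_mulr1 op_mulDl op_mulDr.

Lemma op_sumE (I : Type) (r : seq I) (F : I -> op) s :
  (\sum_(i <- r) F i) s = \sum_(i <- r) F i s.
Proof. exact: (big_morph (fun T : op => T s) (fun _ _ => erefl) erefl). Qed.

Lemma op_prodE (I : Type) (r : seq I) (F : I -> op) s :
  (\prod_(i <- r) F i) s = (\big[comp/id]_(i <- r) F i) s.
Proof.
elim: r s => [|i r IH] s; first by rewrite !big_nil.
by rewrite !big_cons /= -IH.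
Qed.

Lemma op_mulrnE (T : op) n s : (T *+ n) s = T s *+ n.
Proof. by elim: n => [|n IH]; rewrite ?mulr0n // !mulrS -IH. Qed.

End Operators.

Section AltTheory.
Variables (R : realType) (M : manifold R) (A : lie_algebroid M).
Local Notation S := 'Gamma(A).
Local Notation C := (smooth_fun M).

(* Adjacent swaps suffice, because n! w is then the signed sum of w over S_n. *)
Lemma Alt_args n (w : seq S -> C) : alternating w ->
  (forall s1 k u v s2, w (s1 ++ (k *: u + v) :: s2) =
     k *: w (s1 ++ u :: s2) + w (s1 ++ v :: s2)) ->
  Alt (fun a : 'I_n -> S => w (args a)).
Proof.
move=> aw mw; split=> [|tau a].
  case: n => [|n] i a k u v subst; first by have := ltn_ord i.
  have sE z : args (subst z) = insert i z (args (a \o lift i)).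
    rewrite (args_insert _ i) /subst eqxx; congr (insert _ _ (args _)).
    by apply/funext => j /=; rewrite eq_sym (negPf (neq_lift i j)).
  by rewrite !sE mw.
have n0 : n`!%:R != 0 :> R by rewrite pnatr_eq0 -lt0n fact_gt0.
have E b : n`!%:R *: w (args b) =
    \sum_(sigma : 'S_n) (-1) ^+ sigma *: w (args (b \o sigma)).
  rewrite scaler_nat -[n in n`!](size_args b) -asym_alt // -asym_perm.
  by apply: eq_bigr => sigma _; rewrite mulr_sign scaler_sign.
apply: (scalerI n0); rewrite scalerA mulrC -scalerA !E scaler_sumr.
rewrite (reindex_inj (mulIg tau^-1%g)) /=; apply: eq_bigr => sigma _.
rewrite scalerA odd_permM odd_permV addbC signr_addb; congr (_ *: w (args _)).
by apply/funext => i /=; rewrite permM permKV.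
Qed.

Lemma Alt_sub n (eta eta' : cochain A n) : Alt eta -> Alt eta' ->
  Alt (fun a => eta a - eta' a).
Proof.
move=> [m1 s1] [m2 s2]; split=> [i a k u v subst|tau a].
  by rewrite m1 m2 scalerBr !opprD addrACA.
by rewrite s1 s2 scalerBr.
Qed.

Lemma dA_sub n (eta eta' : cochain A n) a :
  dA (fun a => eta a - eta' a) a = dA eta a - dA eta' a.
Proof.
rewrite /dA opprD [RHS]addrACA -!sumrB; congr (_ + _); apply: eq_bigr => i _.
  by rewrite vf_actB scalerBr.
by rewrite -sumrB; apply: eq_bigr => j _; rewrite scalerBr.
Qed.

End AltTheory.

Section OperatorTrace.
Variables (R : realType) (M : manifold R) (E : vbundle M).
Local Notation S := 'Gamma(E).
Local Notation C := (smooth_fun M).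
Local Notation opE := (op S).

Definition op_trace (T : opE) : C := Tr T.
Definition op_tensorial (T : opE) : Prop := tensorial T.

Fact op_scal_subproof (k : R) : rlinear (fun s : S => k *: s).
Proof. by move=> l s u; rewrite scalerDr !scalerA mulrC. Qed.
Definition op_scal (k : R) : opE := Op (op_scal_subproof k).

Fact op_tensorial1 : op_tensorial 1. Proof. by []. Qed.
Fact op_tensorialB x y : op_tensorial x -> op_tensorial y ->
  op_tensorial (x - y).
Proof.
move=> tx ty f s u /=; rewrite tx ty.
by rewrite opprD addrACA secMDr secMNr.
Qed.
Fact op_tensorialM x y : op_tensorial x -> op_tensorial y ->
  op_tensorial (x * y).
Proof. by move=> tx ty f s u /=; rewrite ty tx. Qed.
Fact op_tensorial_scal k : op_tensorial (op_scal k).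
Proof. by move=> f s u /=; rewrite scalerDr !secZE !secMA mulrC. Qed.
Fact op_scal1 : op_scal 1 = 1.
Proof. by apply: op_ext => s /=; rewrite scale1r. Qed.
Fact op_traceD x y : op_tensorial x -> op_tensorial y ->
  op_trace (x + y) = op_trace x + op_trace y.
Proof. exact: TrD. Qed.
Fact op_trace_scal k x : op_tensorial x -> op_trace (op_scal k * x) = k *:
  op_trace x.
Proof. by move=> tx; rewrite sfZE -TrM. Qed.

Fact op_scalC k : central (op_scal k).
Proof.
move=> x; apply: op_ext => s /=.
by rewrite -[k *: s]addr0 opP op_at0 addr0.
Qed.

Definition bundle_trace : trace_data C opE :=
  TraceData op_tensorial1 op_tensorialB op_tensorialM op_tensorial_scal
    op_scal1 op_scalC op_traceD op_trace_scal.

End OperatorTrace.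

Section Connection.
Variables (R : realType) (M : manifold R) (A : lie_algebroid M) (E : vbundle M).
Local Notation C := (smooth_fun M).
Local Notation br := (@bracket _ _ A).
Local Notation rho := (fun a : 'Gamma(A) => vf_act (anchor_vf a)).

Definition conn_op (nabla : connection A E) a : op 'Gamma(E) :=
  Op (fun k s u => linearP (nabla a) k s u).

Lemma conn_leibniz (nabla : connection A E) a :
  cdo_leibniz (conn_op nabla a) (anchor_vf a).
Proof. by rewrite -(conn_symbol nabla a); exact: cdo_symbolP. Qed.

(** By [anchor_bracket], the commutator of nabla_a and nabla_b has the same symbol rho([a,b]) as the
    operator subtracted from it. *)
Lemma curvature_tensorial (nabla : connection A E) a b :
  tensorial (curvature nabla a b).
Proof.
pose D := conn_op nabla.
have := @tensorial_sub _ _ _ (fun s => D a (D b s) - D b (D a s)) (D (br a b))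
  (anchor_vf (br a b)); apply => //.
- by move=> s u; rewrite !opD opprD addrACA.
- exact: opD.
- move=> f s; rewrite !conn_leibniz !opD !conn_leibniz anchor_bracket secMBr
  secMDl secMNl.
  rewrite !opprD [LHS](AC ((2*2)*(2*2)) (((1*5)*(4*8))*((2*7)*(3*6)))) /=.
  by rewrite !subrr !addr0.
- exact: conn_leibniz.
Qed.

Lemma nabla_conn (nabla : connection A E) :
  tr_conn br rho (bundle_trace E) (conn_op nabla).
Proof.
split=> [k a b|a x tx|a x tx|s].
- by apply: op_ext => s /=; rewrite conn_linear.
- exact: (tensorial_commutator (opD _) (conn_leibniz nabla a)).
- exact: (Tr_commutator (opD _) (conn_leibniz nabla a)).
case: s => [|a [|b [|c s]]] /=; try exact: (tame0 (bundle_trace E)).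
exact: curvature_tensorial.
Qed.

(** The signed sum over permutations is [asym] of the p-fold concatenation power of R, hence the
    p-th wedge power of [asym] R = 2R; so 1/2^p leaves R^p. *)
Lemma ch_chern (nabla : connection A E) p :
  ch nabla p = fun a => chern br (bundle_trace E) (conn_op nabla) p (args a).
Proof.
apply/funext => a; congr (Tr _); apply/funext => s.
have r2 t : size t != 2 -> curv br (conn_op nabla) t = 0.
  by case: t => [|? [|? [|? ?]]].
have aR : alternating (curv br (conn_op nabla)).
  by apply: alt_curv; [exact: tr_connD (nabla_conn nabla) | exact: bracketC].
have E2 : asym (curv br (conn_op nabla)) = fun t =>
    curv br (conn_op nabla) t *+ 2.
  apply/funext => t; rewrite asym_alt //.
  have [->|t2] := eqVneq (size t) 2; first by [].
  by rewrite r2 // !mul0rn.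
have : asym (tpow (curv br (conn_op nabla)) p) (args a) =
    shpow (curv br (conn_op nabla)) p (args a) *+ 2 ^ p.
  by rewrite asym_tpow E2 shpow_mulrn.
rewrite -asym_perm => /(congr1 (fun T : op _ => T s));
  rewrite op_mulrnE op_sumE.
rewrite /curvature_pow => H; apply: (@scalerI _ _ (2 ^+ p));
  first by rewrite expf_neq0 ?pnatr_eq0.
rewrite scalerA divff ?scale1r; last by rewrite expf_neq0 ?pnatr_eq0.
rewrite -natrX scaler_nat -H; apply: eq_bigr => tau _.
rewrite -signr_odd -[in RHS]signr_odd mulr_sign scaler_sign.
suff T2 : tpow (curv br (conn_op nabla)) p (args (a \o tau)) s =
    (\big[comp/id]_(i < p) curvature nabla (a (tau (ord_double i)))
       (a (tau (ord_doubleS i)))) s.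
  by case: odd; [exact: (congr1 (fun x => - x) (esym T2)) | exact: (esym T2)].
rewrite (tpow2 0) ?size_args // op_prodE.
congr (_ s); apply: eq_bigr => i _.
rewrite -[i.*2]/(val (ord_double i)) -[i.*2.+1]/(val (ord_doubleS i)) !nth_args.
by [].
Qed.

End Connection.

Theorem corollary1 (R : realType) (M : manifold R) (A : lie_algebroid M)
    (E : vbundle M) (p : nat) (p_ge1 : (1 <= p)%N) :
  (forall nabla : connection A E,
     Alt (ch nabla p) /\ dA (ch nabla p) = (fun=> 0)) /\
  (forall nabla nabla' : connection A E,
     coh_class (ch nabla p) = coh_class (ch nabla' p)).
Proof.
have actP (a : 'Gamma(A)) k f h : vf_act (anchor_vf a) (k *: f + h) =
    k *: vf_act (anchor_vf a) f + vf_act (anchor_vf a) h.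
  by apply: smooth_fun_ext => x /=; rewrite tvec_linear.
have brD := @bracket_linearl _ _ A; have brC := @bracketC _ _ A.
have jac := @bracket_leibniz_jacobi _ _ A.
split=> [nabla|].
  have cD := nabla_conn nabla.
  have aD := alt_chern brC p cD; rewrite ch_chern; split.
    by apply: Alt_args => // s1 k u v s2; apply: (multilin_chern brD brC p cD).
  by apply/funext => a; rewrite dA_dif // (dif_chern jac p _ cD).
(* One inclusion is enough, since the two connections can be exchanged. *)
suff sub (nabla nabla' : connection A E) :
    (coh_class (ch nabla p) `<=` coh_class (ch nabla' p))%classic.
  by move=> nabla nabla'; apply/seteqP; split; exact: sub.
move=> omega [co bo]; split=> //.
have tB a : tame (bundle_trace E) (conn_op nabla' a - conn_op nabla a).
  exact: (tensorial_sub (opD _) (opD _) (conn_leibniz nabla' a) (conn_leibniz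
    nabla a)).
have [th [ath mth dth]] := transgression brD brC jac actP p
  (nabla_conn nabla) (nabla_conn nabla') tB.
move: omega co bo; rewrite !ch_chern.
(* As p >= 1, the degree is a successor and [coboundary] provides a primitive eta of omega -
   ch(nabla). Since d th = ch(nabla') - ch(nabla), the cochain eta - th is a primitive of omega -
   ch(nabla'). *)
case: p p_ge1 dth => // p _ dth omega co /= [eta aeta deta].
exists (fun a => eta a - th (args a)); first by apply: Alt_sub => //;
  apply: Alt_args.
apply/funext => a; rewrite dA_sub deta dA_dif // dth.
by rewrite opprB addrA subrK.
Qed.
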